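(* There is a constant $C(d)>0$ depending only on $d$ such that the following holds. Let $d \geq 1$, let $n_1, \dots, n_d$ be positive integers with $N = n_1 \cdots n_d$, let $0 < \epsilon, \eta < 1$, and let $\Phi \in \mathbb{R}^{m \times N}$ satisfy the $(2 s^d, \delta)$-restricted isometry property for some integer $s \geq \log\frac{1}{\eta} + 2$ and some $\delta \leq C(d)\, \epsilon$. Let $\xi^{(1)} \in \{\pm 1\}^{n_1}, \dots, \xi^{(d)} \in \{\pm 1\}^{n_d}$ be independent Rademacher vectors, let $\xi := \xi^{(1)} \otimes \dots \otimes \xi^{(d)} \in \mathbb{R}^N$, and let $A := \Phi D_{\xi} \in \mathbb{R}^{m \times N}$, where $D_\xi$ is the diagonal matrix with the entries of $\xi$ on its diagonal. Then $A$ satisfies the $(\epsilon, \eta)$ distributional Johnson-Lindenstrauss property, i.e., for every $x \in \mathbb{R}^N$ with $\|x\|_2 = 1$, \[ \mathbb{P}\left( \left| \|A x\|_2^2 - 1 \right| > \epsilon \right) \leq \eta. \]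
   Context: A matrix $\Phi \in \mathbb{R}^{m \times N}$ satisfies the $(k, \delta)$-restricted isometry property (RIP) if $(1-\delta)\|x\|_2^2 \leq \|\Phi x\|_2^2 \leq (1+\delta)\|x\|_2^2$ for all $x \in \mathbb{R}^N$ with at most $k$ nonzero entries. A Rademacher vector has independent entries equal to $\pm 1$ with probability $1/2$ each. The probability is with respect to $\xi^{(1)},\dots,\xi^{(d)}$; $\log$ denotes the natural logarithm. *)

(* Defs.v *)
From mathcomp Require Export all_boot all_order all_algebra.
From mathcomp Require Export all_classical all_reals all_analysis.
From mathcomp Require mxtens.

Export Order.TTheory GRing.Theory Num.Theory.
Export numFieldNormedType.Exports.

#[export] Set Implicit Arguments.
#[export] Unset Strict Implicit.
#[export] Unset Printing Implicit Defensive.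

Open Scope classical_set_scope.
Open Scope ring_scope.

Definition l2norm (R : realType) (n : nat) (x : 'cV[R]_n) : R :=
  Num.sqrt (\sum_(i < n) x i 0 ^+ 2).

Definition RIP (R : realType) (m n : nat) (Phi : 'M[R]_(m, n)) (k : nat)
    (delta : R) : Prop :=
  forall x : 'cV[R]_n, (#|[pred i | (x i 0 != 0)%R]| <= k)%N ->
    (1 - delta) * l2norm x ^+ 2 <= l2norm (Phi *m x) ^+ 2 /\
    l2norm (Phi *m x) ^+ 2 <= (1 + delta) * l2norm x ^+ 2.

(* xi 0 (x) (xi 1 (x) ( ... (x) xi (d-1))), where the library's [tensmx] is
   the binary Kronecker product of matrices; the cast only identifies the
   dimension n_0 * \prod_(j >= 1) n_j with \prod_j n_j. *)
Fixpoint kron (R : realType) (d : nat) :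
    forall n : 'I_d -> nat, (forall j, 'cV[R]_(n j)) ->
    'cV[R]_(\prod_(j < d) n j) :=
  match d return forall n : 'I_d -> nat, (forall j, 'cV[R]_(n j)) ->
    'cV[R]_(\prod_(j < d) n j) with
  | 0 => fun n v => const_mx 1
  | d'.+1 => fun n v =>
      castmx (esym (big_ord_recl d' n), muln1 1)
        (mxtens.tensmx (v ord0) (kron (fun j => v (lift ord0 j))))
  end.

(* The product rule over every subfamily J; measurability of the X i is not part
   of the predicate, it is carried by the random variables it is applied to. *)
Definition mutually_independent (R : realType) (disp : measure_display)
    (T : measurableType disp) (P : probability T R) (I : finType)
    (disp' : measure_display) (S : I -> measurableType disp')
    (X : forall i, T -> S i) : Prop :=
  forall (J : {set I}) (B : forall i, set (S i)),
    (forall i, i \in J -> measurable (B i)) ->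
    P (\bigcap_(i in [set` J]) (X i @^-1` B i)) =
    (\prod_(i in J) P (X i @^-1` B i))%E.

(* The values +1 and -1 are attained almost surely, not necessarily surely. *)
Definition rademacher (R : realType) (disp : measure_display)
    (T : measurableType disp) (P : probability T R) (n : nat)
    (xi : {RV P >-> n.-tuple R}) : Prop :=
  mutually_independent P (fun (i : 'I_n) t => tnth (xi t) i) /\
  forall i : 'I_n,
    P [set t | tnth (xi t) i = 1] = (2^-1)%:E /\
    P [set t | tnth (xi t) i = -1] = (2^-1)%:E.

Definition colvec (R : realType) (n : nat) (v : n.-tuple R) : 'cV[R]_n :=
  \col_i tnth v i.

Definition distributional_JL (R : realType) (disp : measure_display)
    (T : measurableType disp) (P : probability T R) (m n : nat)
    (A : T -> 'M[R]_(m, n)) (epsilon eta : R) : Prop :=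
  forall x : 'cV[R]_n, l2norm x = 1 ->
    (P [set t | epsilon < `| l2norm (A t *m x) ^+ 2 - 1 | ]%R <= eta%:E)%E.

(* Main.v *)
Require Import Defs.
From mathcomp Require Import measurable_realfun ring lra zify.

(* Put B = Phi^T Phi - 1. For a unit vector x and y = D_xi x, the quantity
   |A x|^2 - 1 equals the quadratic form <y, B y>, so it suffices to bound its
   p-th moment for an even p = 2h with s - 1 <= p <= s and apply Markov.

   The idea is to replace each Rademacher vector by a sparse one. Let q_u be a
   probability and let eta_u be 0 with probability 1 - q_u and +-1/sqrt(q_u)
   otherwise. The even moments of eta_u dominate those of a sign, so replacing
   signs by eta only increases the p-th moment of a linear form; for a quadratic
   form the same holds up to a factor C^p, after splitting off the diagonal
   (Jensen) and decoupling the rest with random selectors theta. Taking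
   q_u = min(1, s w_u), where w_u is the share of the mass of x in the u-th slice
   of one tensor factor, the support of eta has size |S| with
   E exp(6|S|) <= exp(e^6 s), and the norm of x grows at most by a power of
   1 + 3|S|/s. Treating the d factors successively, each with weights depending on
   the outcome of the previous ones, confines x to a product set with about s^d
   elements, where the RIP bounds the form by delta. *)

(** * Scalar moment comparison *)

(** Induction on [h]: multiplying the bound for [h] by the mean leaves the gap [q * (1 - q) * ((a -
    b) * (a ^+ h - b ^+ h))], whose two differences have the same sign for nonnegative [a] and
    [b]. *)
Lemma conv_exprn (R : realFieldType) (h : nat) (q a b : R) :
  0 <= q <= 1 -> 0 <= a -> 0 <= b ->
  (q * a + (1 - q) * b) ^+ h <= q * a ^+ h + (1 - q) * b ^+ h.
Proof.
move=> /andP[q0 q1] a0 b0; have q1' : 0 <= 1 - q by rewrite subr_ge0.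
elim: h => [|h IH]; first by rewrite !expr0; lra.
have c0 : 0 <= q * a + (1 - q) * b by rewrite addr_ge0 ?mulr_ge0.
rewrite exprS; apply: le_trans (ler_wpM2l c0 IH) _; rewrite -subr_ge0.
have -> : q * a ^+ h.+1 + (1 - q) * b ^+ h.+1
   - (q * a + (1 - q) * b) * (q * a ^+ h + (1 - q) * b ^+ h)
   = q * (1 - q) * ((a - b) * (a ^+ h - b ^+ h)) by rewrite !exprS; ring.
apply: mulr_ge0; first exact: mulr_ge0.
case: (leP a b) => ab.
  by apply: mulr_le0; rewrite subr_le0 // lerXn2r // nnegrE.
by apply: mulr_ge0; rewrite subr_ge0 ?lerXn2r // ?nnegrE // ltW.
Qed.

Lemma conv_expr_even (R : realFieldType) (h : nat) (q a b : R) :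
  0 <= q <= 1 ->
  (q * a + (1 - q) * b) ^+ (2 * h) <=
    q * a ^+ (2 * h) + (1 - q) * b ^+ (2 * h).
Proof.
move=> q01; rewrite !exprM.
apply: le_trans (conv_exprn h q01 (sqr_ge0 a) (sqr_ge0 b)).
case/andP: q01 => q0 q1.
apply: lerXn2r; rewrite ?nnegrE ?sqr_ge0 //.
  by rewrite addr_ge0 // mulr_ge0 ?sqr_ge0 ?subr_ge0.
rewrite -subr_ge0.
have -> : q * a ^+ 2 + (1 - q) * b ^+ 2 - (q * a + (1 - q) * b) ^+ 2
  = q * (1 - q) * (a - b) ^+ 2 by ring.
by apply: mulr_ge0 (sqr_ge0 _); rewrite mulr_ge0 ?subr_ge0.
Qed.

Lemma mid_expr_even (R : realFieldType) (h : nat) (a b : R) :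
  a ^+ (2 * h) <= 2^-1 * ((a + b) ^+ (2 * h) + (a - b) ^+ (2 * h)).
Proof.
have := @conv_expr_even R h 2^-1 (a + b) (a - b).
rewrite (_ : 2^-1 * (a + b) + (1 - 2^-1) * (a - b) = a); last by field.
move=> /(_ _)/le_trans -> //; lra.
Qed.

(** After binomial expansion the odd powers of [g] cancel on both sides. An even power [i >= 2] of
    [g] gains the factor [r ^- (i - 2) >= 1] on the right, and its cofactor is nonnegative because
    [p - i] is even too. *)
Lemma sparse_sign_moment (R : realFieldType) (h : nat) (r c g : R) :
  0 < r <= 1 ->
  2^-1 * ((c + g) ^+ (2 * h) + (c - g) ^+ (2 * h)) <=
  (1 - r ^+ 2) * c ^+ (2 * h) +
  r ^+ 2 * (2^-1 * ((c + g / r) ^+ (2 * h) + (c - g / r) ^+ (2 * h))).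
Proof.
move=> /andP[r0 r1]; have rn0 : r != 0 by rewrite gt_eqF.
set p := (2 * h)%N.
have E x : 2^-1 * ((c + x) ^+ p + (c - x) ^+ p) =
  \sum_(i < p.+1) 2^-1 * (x ^+ i + (- x) ^+ i) * (c ^+ (p - i) *+ 'C(p, i)).
  rewrite !exprDn -big_split mulr_sumr; apply: eq_bigr => i _ /=.
  rewrite -mulrnDl -mulrDr -[RHS]mulrA; congr (_ * _).
  by rewrite [RHS]mulrnAr mulrC.
(* An indicator of [i = 0] puts the unselected term into the same binomial sum, so that the
   comparison becomes termwise. *)
have E0 : c ^+ p = \sum_(i < p.+1) (i == 0 :> nat)%:R * (c ^+ (p - i) *+ 'C(p, i)).
  rewrite big_ord_recl /= subn0 bin0 mul1r big1 ?addr0 // => i _.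
  by rewrite mul0r.
rewrite !E {1}E0 !mulr_sumr -big_split; apply: ler_sum => i _ /=.
have Z x : 2^-1 * (x ^+ i + (- x) ^+ i) = if odd i then 0 else x ^+ i :> R.
  by rewrite exprNn -signr_odd; case: (odd i); rewrite ?expr1 ?expr0; field.
rewrite [X in _ <= X](_ : _ = ((1 - r ^+ 2) * (i == 0 :> nat)%:R +
    r ^+ 2 * (2^-1 * ((g / r) ^+ i + (- (g / r)) ^+ i))) *
  (c ^+ (p - i) *+ 'C(p, i))); last by rewrite [RHS]mulrDl !mulrA.
rewrite !Z; case: (boolP (odd i)) => oi.
  by case: (i : nat) oi => //= k _; rewrite !mulr0 addr0 mul0r.
apply: ler_wpM2r.
  rewrite mulrn_wge0 // exprn_even_ge0 // oddB ?oddM ?(negbTE oi) //.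
  by rewrite -ltnS.
case: (val i) oi => [|[|k]] //= oi; first by rewrite !expr0; lra.
rewrite mulr0 add0r expr_div_n.
have -> : r ^+ 2 * (g ^+ k.+2 / r ^+ k.+2) = g ^+ k.+2 / r ^+ k.
  rewrite -[k.+2]addn2 [r ^+ (k + 2)]exprD; field.
  by rewrite rn0 expf_neq0.
rewrite ler_peMr //; first by rewrite exprn_even_ge0.
by rewrite invf_ge1 ?exprn_gt0 // exprn_ile1 // ltW.
Qed.

(** * Product measures on finite cubes *)

Definition upd (I : eqType) (V : Type) (v : I -> V) (i : I) (x : V) : I -> V :=
  fun j => if j == i then x else v j.

Definition expect (R : numDomainType) (I O : finType) (mu : I -> O -> R)
    (f : {ffun I -> O} -> R) : R :=
  \sum_(w : {ffun I -> O}) (\prod_i mu i (w i)) * f w.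

Lemma ler_expect (R : numDomainType) (I O : finType) (mu : I -> O -> R) f g :
  (forall i o, 0 <= mu i o) -> (forall w, f w <= g w) ->
  expect mu f <= expect mu g.
Proof.
by move=> mu0 fg; apply: ler_sum => w _; rewrite ler_wpM2l ?prodr_ge0.
Qed.

Lemma expect_prod (R : numDomainType) (I O : finType) (mu g : I -> O -> R) :
  expect mu (fun w => \prod_i g i (w i)) = \prod_i \sum_o mu i o * g i o.
Proof.
rewrite bigA_distr_bigA; apply: eq_bigr => w _.
by rewrite -big_split.
Qed.

Lemma expect_cst (R : numDomainType) (I O : finType) (mu : I -> O -> R) (c : R) :
  (forall i, \sum_o mu i o = 1) -> expect mu (fun=> c) = c.
Proof.
move=> mu1; rewrite /expect -mulr_suml -bigA_distr_bigA big1 ?mul1r //.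
Qed.

Lemma expectZ (R : numDomainType) (I O : finType) (mu : I -> O -> R) (c : R) f :
  expect mu (fun w => c * f w) = c * expect mu f.
Proof. by rewrite mulr_sumr; apply: eq_bigr => w _; rewrite mulrCA. Qed.

Lemma expectD (R : numDomainType) (I O : finType) (mu : I -> O -> R) f g :
  expect mu (fun w => f w + g w) = expect mu f + expect mu g.
Proof. by rewrite -big_split; apply: eq_bigr => w _; rewrite mulrDr. Qed.

(** Exchanging [w i] with the fresh value [o] is an involution on the pairs [(w, o)], so the
    resampled sum is a reindexing of the original one. *)
Lemma sum_resample (R : nmodType) (I O : finType) (i : I)
    (g : {ffun I -> O} -> R) :
  \sum_w g w *+ #|O| =
  \sum_(w : {ffun I -> O}) \sum_(o : O) g (finfun (upd w i o)).
Proof.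
under eq_bigr do rewrite -sumr_const.
rewrite !pair_bigA /=.
pose t (p : {ffun I -> O} * O) := (finfun (upd p.1 i p.2), p.1 i).
have tK : involutive t.
  move=> [w o]; rewrite /t /=; congr (_, _); last by rewrite ffunE /upd eqxx.
  by apply/ffunP => j; rewrite ffunE /upd; case: eqP => [->//|/eqP/negbTE ji];
    rewrite ffunE ji.
by rewrite (reindex_inj (inv_inj tK)).
Qed.

(** Isolates the average over coordinate [i]; the factor [#|O|] counts the values of [w i], on which
    the summand on the right does not depend. *)
Lemma expect_resample (R : numDomainType) (I O : finType) (mu : I -> O -> R)
    (i : I) f :
  expect mu f *+ #|O| = \sum_(w : {ffun I -> O}) (\prod_(j | j != i) mu j (w j)) *
    \sum_o mu i o * f (finfun (upd w i o)).
Proof.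
rewrite /expect -sumrMnl (sum_resample i); apply: eq_bigr => w _.
rewrite mulr_sumr; apply: eq_bigr => o _.
rewrite (bigD1 i) //= ffunE /upd eqxx mulrCA mulrA; congr (_ * _); congr (_ * _).
by apply: eq_bigr => j /negbTE ji; rewrite ffunE /upd ji.
Qed.

(* Lindeberg exchange: coordinates are replaced one at a time. *)
Lemma expect_replace (R : numDomainType) (I O : finType) (V : Type)
    (mu : I -> O -> R) (F : (I -> V) -> R) (X Y : I -> O -> V) :
  (0 < #|O|)%N -> (forall i o, 0 <= mu i o) ->
  (forall i v, \sum_o mu i o * F (upd v i (X i o)) <=
               \sum_o mu i o * F (upd v i (Y i o))) ->
  expect mu (fun w => F (fun i => X i (w i))) <=
  expect mu (fun w => F (fun i => Y i (w i))).
Proof.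
move=> O0 mu0 XY.
(* Hybrid family: the coordinates in [r] have already switched from [X] to [Y]. *)
pose Z (r : seq I) i o := if i \in r then Y i o else X i o.
suff H r : expect mu (fun w => F (fun i => X i (w i))) <=
    expect mu (fun w => F (fun i => Z r i (w i))).
  have := H (enum I); congr (_ <= expect mu _); apply: funext => w.
  by congr F; apply: funext => i; rewrite /Z mem_enum.
elim: r => [|i r IH] //; apply: le_trans IH _.
case: (boolP (i \in r)) => ir.
  rewrite le_eqVlt; apply/orP; left; apply/eqP.
  congr (expect mu _); apply: funext => w.
  congr F; apply: funext => j; rewrite /Z inE; case: eqP => // ->.
  by rewrite ir.
rewrite -(ler_pMn2r O0) !(expect_resample _ i); apply: ler_sum => w _.
apply: ler_wpM2l; first exact: prodr_ge0.
have {XY}:= XY i (fun j => Z r j (w j)).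
congr (_ <= _); apply: eq_bigr => o _; congr (_ * F _); apply: funext => j;
  rewrite /Z ffunE /upd ?inE; case: eqP => [->|_] //.
by rewrite (negbTE ir).
Qed.

(** * Sparsification of one block of signs *)

(* An outcome (e, b, th) consists of a sign bit e, a selection bit b (true with
   probability q = r ^+ 2) and the decoupling selector th. *)
Definition sparse_law (R : realFieldType) (I : finType) (r : I -> R) (i : I)
    (o : bool * bool * bool) : R :=
  4^-1 * (if o.1.2 then r i ^+ 2 else 1 - r i ^+ 2).

Definition sparse_sign (R : realFieldType) (I : finType) (r : I -> R) (i : I)
    (o : bool * bool * bool) : R :=
  if o.1.2 then (-1) ^+ o.1.1 / r i else 0.

(** The factor 2 compensates the probability 1/2 of each selector value. The left and right
    coefficients of one coordinate are never both nonzero, so a form pairing them has no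
    diagonal. *)
Definition sparse_left (R : realFieldType) (I : finType) (r : I -> R) (i : I)
    (o : bool * bool * bool) : R := 2 * o.2%:R * sparse_sign r i o.

Definition sparse_right (R : realFieldType) (I : finType) (r : I -> R) (i : I)
    (o : bool * bool * bool) : R := 2 * (~~ o.2)%:R * sparse_sign r i o.

Lemma sum_bool3 (R : realFieldType) (f : bool * bool * bool -> R) :
  \sum_o f o =
  f (true, true, true) + f (true, true, false) + f (true, false, true) +
  f (true, false, false) + f (false, true, true) + f (false, true, false) +
  f (false, false, true) + f (false, false, false).
Proof.
transitivity (\sum_(a : bool) \sum_(b : bool) \sum_(c : bool) f (a, b, c)).
  by rewrite !pair_bigA; apply: eq_bigr => -[[]].
by rewrite !big_bool /= !addrA.
Qed.

Lemma sparse_law_ge0 (R : realFieldType) (I : finType) (r : I -> R) i o :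
  0 < r i <= 1 -> 0 <= sparse_law r i o.
Proof.
move=> /andP[r0 r1]; rewrite mulr_ge0 ?invr_ge0 //.
by case: ifP; rewrite ?sqr_ge0 // subr_ge0 exprn_ile1 // ltW.
Qed.

Lemma sparse_law1 (R : realFieldType) (I : finType) (r : I -> R) i :
  \sum_o sparse_law r i o = 1.
Proof. by rewrite sum_bool3 /sparse_law /=; field. Qed.

(** Since [c + a + b] is the midpoint of [c + 2 * a] and [c + 2 * b], convexity passes to the two
    selector values; [sparse_sign_moment] then makes the sign sparse. *)
Lemma decouple_coord (R : realFieldType) (h : nat) (I : finType) (r : I -> R)
    (i : I) (c a b : R) : 0 < r i <= 1 ->
  \sum_o sparse_law r i o * (c + a * (-1) ^+ o.1.1 + b * (-1) ^+ o.1.1) ^+ (2 * h)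
  <= \sum_o sparse_law r i o *
     (c + a * (2 * o.2%:R * sparse_sign r i o) +
      b * (2 * (~~ o.2)%:R * sparse_sign r i o)) ^+ (2 * h).
Proof.
move=> ri.
have Ha := sparse_sign_moment h c (2 * a) ri.
have Hb := sparse_sign_moment h c (2 * b) ri.
have h2 : 0 <= (2^-1 : R) <= 1 by lra.
have Hp := conv_expr_even h (c + 2 * a) (c + 2 * b) h2.
have Hm := conv_expr_even h (c - 2 * a) (c - 2 * b) h2.
rewrite !sum_bool3 /sparse_law /sparse_sign /=.
rewrite !expr1 !expr0 !mulr0 !mul0r !mulr0 !addr0.
have E1 : 2^-1 * (c + 2 * a) + (1 - 2^-1) * (c + 2 * b) = c + a * 1 + b * 1.
  by field.
have E2 : 2^-1 * (c - 2 * a) + (1 - 2^-1) * (c - 2 * b) = c + a * -1 + b * -1.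
  by field.
rewrite E1 in Hp; rewrite E2 in Hm.
have E3 (x : R) : x * (2 * 1 * (1 / r i)) = 2 * x / r i by ring.
have E4 (x : R) : x * (2 * 1 * (-1 / r i)) = - (2 * x / r i) by ring.
rewrite !E3 !E4.
lra.
Qed.

(** Given selection, averaging over the sign removes the linear terms by [mid_expr_even]; the square
    of the sparse sign has mean 1, so convexity in the selection bit does the rest. *)
Lemma diag_coord (R : realFieldType) (h : nat) (I : finType) (r : I -> R)
    (i : I) (c a b g : R) : 0 < r i <= 1 ->
  \sum_o sparse_law r i o * (c + a * 0 + b * 0 + g * 1) ^+ (2 * h)
  <= \sum_o sparse_law r i o *
     (c + a * sparse_sign r i o + b * sparse_sign r i o
       + g * sparse_sign r i o ^+ 2) ^+ (2 * h).
Proof.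
move=> ri; have /andP[r0 r1] := ri; have rn0 : r i != 0 by rewrite gt_eqF.
have q01 : 0 <= r i ^+ 2 <= 1 by rewrite sqr_ge0 exprn_ile1 // ltW.
have H1 := conv_expr_even h (c + g / r i ^+ 2) c q01.
have H2 := mid_expr_even h (c + g / r i ^+ 2) ((a + b) / r i).
have E1 : r i ^+ 2 * (c + g / r i ^+ 2) + (1 - r i ^+ 2) * c = c + g by field.
rewrite E1 in H1.
have r2 : 0 <= r i ^+ 2 by rewrite sqr_ge0.
have {}H2 := ler_wpM2l r2 H2.
rewrite !sum_bool3 /sparse_law /sparse_sign /=.
rewrite !expr1 !expr0 !expr0n !mulr0 !addr0 mulr1.
have E2 : c + a * (-1 / r i) + b * (-1 / r i) + g * (-1 / r i) ^+ 2 =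
  c + g / r i ^+ 2 - (a + b) / r i by field.
have E3 : c + a * (1 / r i) + b * (1 / r i) + g * (1 / r i) ^+ 2 =
  c + g / r i ^+ 2 + (a + b) / r i by field.
rewrite E2 E3; lra.
Qed.

(* Each coordinate carries a triple (a, b, c) in place of (xi_i, xi_i, xi_i ^ 2), so
   that the form is affine in each coordinate separately: (e, e, 0) gives the
   off-diagonal part and (0, 0, 1) the diagonal part. *)
Definition block_form (R : realFieldType) (h : nat) (I : finType)
    (G : I -> I -> R) (v : I -> R * R * R) : R :=
  (\sum_i ((\sum_(j | j != i) G i j * (v i).1.1 * (v j).1.2) +
           G i i * (v i).2)) ^+ (2 * h).

Lemma block_form_affine (R : realFieldType) (h : nat) (I : finType)
    (G : I -> I -> R) (i : I) (v : I -> R * R * R) :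
  exists c a b g, forall x, block_form h G (upd v i x) =
    (c + a * x.1.1 + b * x.1.2 + g * x.2) ^+ (2 * h).
Proof.
exists (\sum_(k | k != i) ((\sum_(j | (j != k) && (j != i))
            G k j * (v k).1.1 * (v j).1.2) + G k k * (v k).2)).
exists (\sum_(j | j != i) G i j * (v j).1.2).
exists (\sum_(k | k != i) G k i * (v k).1.1).
exists (G i i) => x; rewrite /block_form; congr (_ ^+ _).
rewrite (bigD1 i) //= /upd eqxx addrC addrA; congr (_ + _).
rewrite [RHS]addrAC; congr (_ + _); last first.
  by rewrite mulr_suml; apply: eq_bigr => j /negbTE ->; rewrite mulrAC.
rewrite mulr_suml -big_split; apply: eq_bigr => k ki /=.
rewrite (negbTE ki) (bigD1 i) 1?eq_sym //= eqxx -addrA addrC.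
congr (_ + _).
by congr (_ + _); apply: eq_bigr => j /andP[_ /negbTE ->].
Qed.

Definition form_moment (R : numDomainType) (h : nat) (I O : finType)
    (mu : I -> O -> R) (G : I -> I -> R) (x y : I -> O -> R) : R :=
  expect mu
    (fun w => (\sum_i \sum_j G i j * x i (w i) * y j (w j)) ^+ (2 * h)).

(** Convexity separates the diagonal from the off-diagonal part at the price of [2 ^+ (2 * h)], and
    [expect_replace] then treats each part. *)
Lemma block_decouple (R : realFieldType) (h : nat) (I : finType) (r : I -> R)
    (G : I -> I -> R) (r01 : forall i, 0 < r i <= 1) :
  form_moment h (sparse_law r) G
    (fun _ o => (-1) ^+ o.1.1) (fun _ o => (-1) ^+ o.1.1) <=
  2^-1 * 2 ^+ (2 * h) * (
    form_moment h (sparse_law r) G (sparse_sign r) (sparse_sign r) +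
    form_moment h (sparse_law r) G
      (sparse_left r) (sparse_right r)).
Proof.
rewrite /form_moment.
have O0 : (0 < #|{: bool * bool * bool}|)%N by rewrite !card_prod card_bool.
have mu0 i o : 0 <= sparse_law r i o by exact: sparse_law_ge0.
pose e (o : bool * bool * bool) : R := (-1) ^+ o.1.1.
have Hoff : expect (sparse_law r)
    (fun w => block_form h G (fun i => (e (w i), e (w i), 0))) <=
  form_moment h (sparse_law r) G
      (sparse_left r) (sparse_right r).
  apply: le_trans (@expect_replace _ _ _ _ _ (block_form h G)
    (fun _ o => (e o, e o, 0))
    (fun i o => (sparse_left r i o, sparse_right r i o, 0)) O0 mu0 _) _.
    move=> i v; have [c [a [b [g cabg]]]] := block_form_affine h G i v.
    under eq_bigr do rewrite cabg /= mulr0 addr0.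
    under [X in _ <= X]eq_bigr do rewrite cabg /= mulr0 addr0.
    exact: decouple_coord.
  apply: ler_expect => // w; rewrite /block_form; rewrite le_eqVlt; apply/predU1P; left.
  congr (_ ^+ _); apply: eq_bigr => i _ /=; rewrite mulr0 addr0.
  rewrite [RHS](bigD1 i) //= -[LHS]add0r; congr (_ + _).
  by rewrite /sparse_left /sparse_right; case: (w i).2; rewrite /= !(mulr0, mul0r).
(* Passing from [(0, 0, 1)] to the sparse triple also brings in off-diagonal terms, so the constant
   diagonal is bounded by a moment of the full sparse form. *)
have Hdiag : expect (sparse_law r)
    (fun w => block_form h G (fun i => (0, 0, 1))) <=
  form_moment h (sparse_law r) G (sparse_sign r) (sparse_sign r).
  apply: le_trans (@expect_replace _ _ _ _ _ (block_form h G)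
    (fun _ o => (0, 0, 1))
    (fun i o => (sparse_sign r i o, sparse_sign r i o, sparse_sign r i o ^+ 2))
    O0 mu0 _) _.
    move=> i v; have [c [a [b [g cabg]]]] := block_form_affine h G i v.
    under eq_bigr do rewrite cabg.
    under [X in _ <= X]eq_bigr do rewrite cabg.
    exact: diag_coord.
  apply: ler_expect => // w; rewrite /block_form; rewrite le_eqVlt; apply/predU1P; left.
  congr (_ ^+ _); apply: eq_bigr => i _ /=.
  by rewrite [RHS](bigD1 i) //= addrC expr2 mulrA.
apply: (@le_trans _ _ (2^-1 * 2 ^+ (2 * h) * (expect (sparse_law r)
    (fun w => block_form h G (fun i => (0, 0, 1))) + expect (sparse_law r)
    (fun w => block_form h G (fun i => (e (w i), e (w i), 0)))))); last first.
  by rewrite ler_wpM2l ?lerD // mulr_ge0 ?invr_ge0 // exprn_ge0.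
rewrite -expectD -expectZ; apply: ler_expect => // w.
rewrite /block_form -mulrA mulrDr -!exprMn mulrDr.
set D := \sum_i (_ + _); set O := \sum_i (_ + _).
have -> : \sum_i \sum_j G i j * e (w i) * e (w j) = D + O.
  rewrite -big_split; apply: eq_bigr => i _ /=.
  rewrite [X in _ = X + _ + _]big1 => [|j _]; last by rewrite !mulr0.
  rewrite add0r mulr1 mulr0 addr0 (bigD1 i) //=; congr (_ + _).
  by rewrite -mulrA -expr2 sqrr_sign mulr1.
have h2 : 0 <= (2^-1 : R) <= 1 by lra.
have := conv_expr_even h (2 * D) (2 * O) h2.
rewrite (_ : _ + _ = D + O); last by field.
by rewrite (_ : 1 - 2^-1 = 2^-1); last by field.
Qed.

(** * Sign averages of bilinear forms *)

Lemma expect_sum (R : numDomainType) (I O S : finType) (mu : I -> O -> R)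
    (f : S -> {ffun I -> O} -> R) :
  expect mu (fun w => \sum_s f s w) = \sum_s expect mu (f s).
Proof.
rewrite exchange_big; apply: eq_bigr => w _.
by rewrite mulr_sumr.
Qed.

Definition bil (R : pzRingType) (K : finType) (B : K -> K -> R) (y z : K -> R) : R :=
  \sum_k \sum_l B k l * y k * z l.

Definition nsq (R : pzRingType) (K : finType) (y : K -> R) : R :=
  \sum_k y k ^+ 2.

Lemma bil_block (R : comNzRingType) (K J : finType) (B : K -> K -> R)
    (rho : K -> J) (a b : J -> R) (y z : K -> R) :
  bil B (fun k => a (rho k) * y k) (fun k => b (rho k) * z k) =
  \sum_u \sum_v (\sum_(k | rho k == u) \sum_(l | rho l == v) B k l * y k * z l)
    * a u * b v.
Proof.
rewrite /bil (partition_big rho xpredT) //=; apply: eq_bigr => u _.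
under eq_bigr => k _ do rewrite (partition_big rho xpredT) //=.
rewrite exchange_big; apply: eq_bigr => v _; rewrite -mulrA mulr_suml.
apply: eq_bigr => k /eqP <-; rewrite mulr_suml; apply: eq_bigr => l /eqP <-.
ring.
Qed.

(** In the application [J] is the disjoint union of the index sets of all tensor factors and
    [rho j k] is the tagged [j]-th coordinate of [k]; this is then entry [k] of a Kronecker product
    of sign vectors. *)
Definition flip (R : pzRingType) (K J : finType) (d : nat) (rho : 'I_d -> K -> J)
    (s : {ffun J -> bool}) (k : K) : R :=
  \prod_j (-1) ^+ s (rho j k).

Definition sign_moment (R : comUnitRingType) (K J : finType) (d : nat)
    (rho : 'I_d -> K -> J) (B : K -> K -> R) (h : nat) (y z : K -> R) : R :=
  2^-1 ^+ #|J| * \sum_(s : {ffun J -> bool})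
    bil B (fun k => flip R rho s k * y k) (fun k => flip R rho s k * z k)
      ^+ (2 * h).

(** The uniform law on sign patterns is invariant under pointwise xor with [t]. *)
Lemma sign_moment_flip (R : comUnitRingType) (K J : finType) (d : nat)
    (rho : 'I_d -> K -> J) (B : K -> K -> R) (h : nat) (y z : K -> R) t :
  sign_moment rho B h (fun k => flip R rho t k * y k)
    (fun k => flip R rho t k * z k) = sign_moment rho B h y z.
Proof.
congr (_ * _); pose f (s : {ffun J -> bool}) := [ffun u => s u (+) t u].
have fK : involutive f by move=> s; apply/ffunP => u; rewrite !ffunE addbK.
rewrite [RHS](reindex_inj (inv_inj fK)); apply: eq_bigr => s _.
have fE k : flip R rho (f s) k = flip R rho s k * flip R rho t k.
  rewrite /flip -big_split; apply: eq_bigr => j _.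
  by rewrite ffunE signr_addb.
by congr (bil _ _ _ ^+ _); apply: funext => k; rewrite fE mulrA.
Qed.

Definition rescale (R : pzRingType) (K J O : finType) (rho : K -> J)
    (x : J -> O -> R) (w : {ffun J -> O}) (y : K -> R) (k : K) : R :=
  x (rho k) (w (rho k)) * y k.

(** By sign invariance the signs of factor [j] may be drawn afresh from the sign bits of
    [sparse_law]. For a fixed pattern [s] the form is quadratic in these signs, with coefficients
    summed over the fibres of [rho j], so [block_decouple] applies. *)
Lemma sign_moment_block (R : realFieldType) (K J : finType) (d : nat)
    (rho : 'I_d -> K -> J) (blk : J -> 'I_d)
    (blkK : forall j k, blk (rho j k) = j)
    (B : K -> K -> R) (h : nat) (r : J -> R) (j : 'I_d) (y z : K -> R) :
  (forall u, 0 < r u <= 1) ->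
  sign_moment rho B h y z <= 2^-1 * 2 ^+ (2 * h) * (
    expect (sparse_law r) (fun w => sign_moment rho B h
      (rescale (rho j) (sparse_sign r) w y) (rescale (rho j) (sparse_sign r) w z)) +
    expect (sparse_law r) (fun w => sign_moment rho B h
      (rescale (rho j) (sparse_left r) w y)
      (rescale (rho j) (sparse_right r) w z))).
Proof.
move=> r01.
have H (x x' : J -> bool * bool * bool -> R) :
  expect (sparse_law r) (fun w => sign_moment rho B h
    (rescale (rho j) x w y) (rescale (rho j) x' w z))
  = 2^-1 ^+ #|J| * \sum_(s : {ffun J -> bool}) form_moment h (sparse_law r)
     (fun u v => \sum_(k | rho j k == u) \sum_(l | rho j l == v)
        B k l * (flip R rho s k * y k) * (flip R rho s l * z l)) x x'.
  rewrite /sign_moment expectZ expect_sum; congr (_ * _); apply: eq_bigr => s _.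
  congr (expect _ _); apply: funext => w; congr (_ ^+ _).
  rewrite -(bil_block B (rho j) (fun u => x u (w u)) (fun u => x' u (w u))).
  by congr bil; apply: funext => k; rewrite /rescale mulrCA.
pose e (u : J) (o : bool * bool * bool) : R := (-1) ^+ o.1.1.
have -> : sign_moment rho B h y z = expect (sparse_law r)
    (fun w => sign_moment rho B h (rescale (rho j) e w y) (rescale (rho j) e w z)).
  rewrite -[LHS](@expect_cst _ _ _ (sparse_law r)); last exact: sparse_law1.
  congr expect; apply: funext => w.
  (* This pattern flips only labels of block [j], recognised by [blk]; the other factors of [flip]
     are 1. *)
  rewrite -(sign_moment_flip _ _ _ _ _ [ffun u => (blk u == j) && (w u).1.1]).
  congr (sign_moment _ _ _ _ _); apply: funext => k; congr (_ * _);
    rewrite /flip (bigD1 j) //= ffunE blkK eqxx big1 ?mulr1 // => i ij;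
    by rewrite ffunE blkK (negbTE ij).
rewrite !H -mulrDr mulrCA; apply: ler_wpM2l; first by rewrite exprn_ge0 ?invr_ge0.
rewrite -big_split mulr_sumr; apply: ler_sum => s _ /=.
exact: block_decouple.
Qed.

Lemma nsq_ge0 (R : realFieldType) (K : finType) (y : K -> R) : 0 <= nsq y.
Proof. by apply: sumr_ge0 => k _; exact: sqr_ge0. Qed.

Lemma flip_sqr (R : realFieldType) (K J : finType) (d : nat)
    (rho : 'I_d -> K -> J) s k : flip R rho s k ^+ 2 = 1.
Proof.
rewrite /flip -prodrXl big1 // => j _; exact: sqrr_sign.
Qed.

Lemma nsq_flip (R : realFieldType) (K J : finType) (d : nat)
    (rho : 'I_d -> K -> J) s (y : K -> R) :
  nsq (fun k => flip R rho s k * y k) = nsq y.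
Proof. by apply: eq_bigr => k _; rewrite exprMn flip_sqr mul1r. Qed.

Lemma sign_moment_le (R : realFieldType) (K J : finType) (d : nat)
    (rho : 'I_d -> K -> J) (B : K -> K -> R) (h : nat) (y z : K -> R) (M : R) :
  (forall s : {ffun J -> bool}, bil B (fun k => flip R rho s k * y k)
     (fun k => flip R rho s k * z k) ^+ 2 <= M) ->
  sign_moment rho B h y z <= M ^+ h.
Proof.
move=> bM.
have M0 : 0 <= M by exact: le_trans (sqr_ge0 _) (bM [ffun=> false]).
apply: (@le_trans _ _ (2^-1 ^+ #|J| * \sum_(s : {ffun J -> bool}) M ^+ h)).
  rewrite ler_wpM2l ?exprn_ge0 ?invr_ge0 //; apply: ler_sum => s _.
  by rewrite exprM lerXn2r // nnegrE ?sqr_ge0.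
by rewrite sumr_const card_ffun card_bool -[_ *+ (2 ^ _)]mulr_natl natrX mulrA -exprMn
  mulVf // expr1n mul1r.
Qed.

(** Split the fibre by the value of [rho i]: there are [#|S|] values, and each nonempty piece lies
    in a fibre of [W] for [i :: L]. *)
Lemma card_fiber_restrict (K J : finType) (I : eqType) (rho : I -> K -> J)
    (i : I) (L : seq I) (W : {set K}) (S : {set J}) (c : nat) :
  (forall k, k \in W ->
    #|[set k' in W | all (fun j => rho j k' == rho j k) (i :: L)]| <= c)%N ->
  forall k, (#|[set k' in [set k in W | rho i k \in S]
               | all (fun j => rho j k' == rho j k) L]| <= c * #|S|)%N.
Proof.
move=> Wc k; rewrite -sum1_card (partition_big (rho i) (mem S)) /=; last first.
  by move=> k'; rewrite !inE => /andP[/andP[]].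
rewrite mulnC -sum_nat_const; apply: leq_sum => u uS; rewrite sum1_card.
set A := (X in #|X|).
have [k0 k0A|A0] := pickP A; last by rewrite eq_card0.
have k0W : k0 \in W by move: k0A; rewrite /A /= !inE => /andP[/andP[/andP[]]].
apply: leq_trans (Wc _ k0W); apply: subset_leq_card; apply/fintype.subsetP => k'.
move: k0A; rewrite /A /= !inE /= => /andP[/andP[_ k0L] /eqP k0u].
rewrite [_ \in (fun=> _)]unfold_in !inE => /andP[/andP[/andP[-> _] k'L] /eqP k'u].
rewrite k0u k'u eqxx /=.
apply/allP => j jL; move/allP: k0L => /(_ _ jL) /eqP ->.
by move/allP: k'L => /(_ _ jL).
Qed.

(** * Slices and importance weights *)

Definition slice (R : pzRingType) (K J : finType) (rho : K -> J) (y : K -> R)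
    (u : J) : R := \sum_(k | rho k == u) y k ^+ 2.

Lemma slice_ge0 (R : realFieldType) (K J : finType) (rho : K -> J) (y : K -> R) u :
  0 <= slice rho y u.
Proof. by apply: sumr_ge0 => k _; exact: sqr_ge0. Qed.

Lemma sum_slice (R : pzRingType) (K J : finType) (rho : K -> J) (y : K -> R) :
  \sum_u slice rho y u = nsq y.
Proof. by rewrite /nsq (partition_big rho xpredT). Qed.

Lemma nsq_rescale (R : realFieldType) (K J O : finType) (rho : K -> J)
    (x : J -> O -> R) w (y : K -> R) :
  nsq (rescale rho x w y) = \sum_u x u (w u) ^+ 2 * slice rho y u.
Proof.
rewrite /nsq (partition_big rho xpredT) //=; apply: eq_bigr => u _.
by rewrite mulr_sumr; apply: eq_bigr => k /eqP <-; rewrite exprMn.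
Qed.

(* The term 1 / #|J| only keeps the weight positive when both slices vanish. *)
Definition importance (R : realFieldType) (K J : finType) (rho : K -> J)
    (y z : K -> R) (u : J) : R :=
  (slice rho y u / nsq y + slice rho z u / nsq z + #|J|%:R^-1) / 3.

Lemma importance_gt0 (R : realFieldType) (K J : finType) (rho : K -> J)
    (y z : K -> R) (u : J) : 0 < importance rho y z u.
Proof.
rewrite divr_gt0 // ltr_wpDl ?addr_ge0 ?divr_ge0 ?slice_ge0 ?nsq_ge0 //.
by rewrite invr_gt0 ltr0n; apply/card_gt0P; exists u.
Qed.

(** Covers [a = 0], where the quotient is 0: a vanishing norm or an empty [J]. *)
Lemma divff_le1 (R : realFieldType) (a : R) : a / a <= 1.
Proof. by have [->|a0] := eqVneq a 0; rewrite ?mul0r // divff. Qed.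

Lemma sum_importance (R : realFieldType) (K J : finType) (rho : K -> J)
    (y z : K -> R) : \sum_u importance rho y z u <= 1.
Proof.
rewrite /importance -mulr_suml !big_split /= -!mulr_suml !sum_slice sumr_const.
rewrite -[_ *+ _]mulr_natl.
have := divff_le1 (nsq y); have := divff_le1 (nsq z).
have := divff_le1 (#|J|%:R : R); lra.
Qed.

Lemma slice_importance (R : realFieldType) (K J : finType) (rho : K -> J)
    (y z : K -> R) (u : J) :
  slice rho y u <= 3 * importance rho y z u * nsq y /\
  slice rho z u <= 3 * importance rho y z u * nsq z.
Proof.
(* If [nsq x = 0] the quotient is 0 by convention, but then every slice vanishes as well. *)
have H (x : K -> R) : slice rho x u = slice rho x u / nsq x * nsq x.
  have [x0|x0] := eqVneq (nsq x) 0; last by rewrite divfK.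
  rewrite x0 mulr0; apply/eqP; rewrite eq_le slice_ge0 andbT -x0 -(sum_slice rho).
  rewrite (bigD1 u) //= lerDl; apply: sumr_ge0 => v _; exact: slice_ge0.
rewrite [X in X <= _]H [X in _ /\ X <= _]H /importance; split;
  apply: ler_wpM2r (nsq_ge0 _) _ _ _;
  have := divr_ge0 (slice_ge0 rho y u) (nsq_ge0 y);
  have := divr_ge0 (slice_ge0 rho z u) (nsq_ge0 z);
  have : 0 <= (#|J|%:R^-1 : R) by []; lra.
Qed.

(** One bound for the three kinds of coefficient lets the diagonal and decoupled terms be treated
    alike. *)
Lemma sparse_coef_sqr (R : realFieldType) (J : finType) (r : J -> R) u o :
  0 < r u ->
  [/\ sparse_sign r u o ^+ 2 <= if o.1.2 then 4 / r u ^+ 2 else 0,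
      sparse_left r u o ^+ 2 <= if o.1.2 then 4 / r u ^+ 2 else 0 &
      sparse_right r u o ^+ 2 <= if o.1.2 then 4 / r u ^+ 2 else 0].
Proof.
move=> r0; rewrite /sparse_left /sparse_right !exprMn.
have i0 : 0 < (r u ^+ 2)^-1 by rewrite invr_gt0 exprn_gt0.
have -> : sparse_sign r u o ^+ 2 = if o.1.2 then (r u ^+ 2)^-1 else 0.
  rewrite /sparse_sign; case: ifP => _; last by rewrite expr0n.
  by rewrite exprMn sqrr_sign mul1r exprVn.
by case: o.1.2; case: o.2; split; rewrite /= ?expr0n ?expr1n /=; lra.
Qed.

(** * Random supports *)

Definition retained (J : finType) (w : {ffun J -> bool * bool * bool}) : {set J} :=
  [set u | (w u).1.2].

Definition keep_prob (R : realType) (K J : finType) (rho : K -> J) (s : nat)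
    (y z : K -> R) (u : J) : R :=
  Num.min 1 (s%:R * importance rho y z u).

Definition keep_root (R : realType) (K J : finType) (rho : K -> J) (s : nat)
    (y z : K -> R) (u : J) : R := Num.sqrt (keep_prob rho s y z u).

Lemma keep_prob_gt0 (R : realType) (K J : finType) (rho : K -> J) (s : nat)
    (y z : K -> R) (u : J) : (0 < s)%N -> 0 < keep_prob rho s y z u.
Proof.
by move=> s0; rewrite lt_min ltr01 mulr_gt0 ?ltr0n // importance_gt0.
Qed.

Lemma keep_root_range (R : realType) (K J : finType) (rho : K -> J) (s : nat)
    (y z : K -> R) (u : J) : (0 < s)%N -> 0 < keep_root rho s y z u <= 1.
Proof.
move=> s0; rewrite sqrtr_gt0 keep_prob_gt0 //= -[leRHS]sqrtr1.
by rewrite ler_wsqrtr // ge_min lexx.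
Qed.

Lemma keep_root_sqr (R : realType) (K J : finType) (rho : K -> J) (s : nat)
    (y z : K -> R) (u : J) : (0 < s)%N ->
  keep_root rho s y z u ^+ 2 = keep_prob rho s y z u.
Proof. by move=> s0; rewrite sqr_sqrtr // ltW // keep_prob_gt0. Qed.

Lemma sum_keep_prob (R : realType) (K J : finType) (rho : K -> J) (s : nat)
    (y z : K -> R) : \sum_u keep_prob rho s y z u <= s%:R.
Proof.
apply: (@le_trans _ _ (s%:R * \sum_u importance rho y z u)).
  by rewrite mulr_sumr; apply: ler_sum => u _; rewrite ge_min lexx orbT.
by rewrite ler_piMr // sum_importance.
Qed.

(** A retained slice with keep probability 1 costs 4 times its mass. Otherwise its mass divided by
    [s%:R * importance rho y z u] is at most [3 * nsq v / s%:R], whatever [u] is; summing this over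
    the retained labels gives the term in [#|retained w|]. *)
Lemma nsq_retained (R : realType) (K J : finType) (rho : K -> J) (s : nat)
    (y z v : K -> R) (x : J -> bool * bool * bool -> R)
    (w : {ffun J -> bool * bool * bool}) : (0 < s)%N ->
  (forall u, slice rho v u <= 3 * importance rho y z u * nsq v) ->
  (forall u o, x u o ^+ 2 <=
     if o.1.2 then 4 / keep_root rho s y z u ^+ 2 else 0) ->
  nsq (rescale rho x w v) <=
    4 * (1 + 3 * (#|retained w|%:R / s%:R)) * nsq v.
Proof.
move=> s0 vi x4; rewrite nsq_rescale.
have sR : 0 < (s%:R : R) by rewrite ltr0n.
apply: (@le_trans _ _ (\sum_(u in retained w)
    (4 * slice rho v u + 12 * nsq v / s%:R))).
  rewrite [leRHS]big_mkcond; apply: ler_sum => u _.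
  rewrite inE; have := x4 u (w u); case: ifP => _ xw; last first.
    have -> : x u (w u) ^+ 2 = 0 by apply/eqP; rewrite eq_le xw sqr_ge0.
    by rewrite mul0r.
  apply: le_trans (ler_wpM2r (slice_ge0 _ _ _) xw) _.
  rewrite keep_root_sqr // /keep_prob minEle.
  have n0 := nsq_ge0 v; have v0 := slice_ge0 rho v u.
  case: ifP => _.
    by rewrite divr1 lerDl divr_ge0 // mulr_ge0.
  rewrite -[leLHS]add0r lerD ?mulr_ge0 //.
  have i0 := importance_gt0 rho y z u.
  rewrite -mulrA -mulrA; apply: (@le_trans _ _
     (4 * ((s%:R * importance rho y z u)^-1 * (3 * importance rho y z u * nsq v)))).
    by rewrite ler_pM2l // ler_wpM2l ?vi // invr_ge0 mulr_ge0 // ltW.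
  rewrite le_eqVlt; apply/predU1P; left; field.
  by rewrite !gt_eqF.
rewrite big_split /= sumr_const -mulr_sumr.
have H : \sum_(u in retained w) slice rho v u <= nsq v.
  rewrite -(sum_slice rho) [leLHS]big_mkcond; apply: ler_sum => u _.
  by case: ifP => _ //; exact: slice_ge0.
rewrite -[_ *+ #|_|]mulr_natl.
have -> : 4 * (1 + 3 * (#|retained w|%:R / s%:R)) * nsq v =
  4 * nsq v + #|retained w|%:R * (12 * nsq v / s%:R) by ring.
by rewrite lerD2r ler_pM2l.
Qed.

(** The exponential factorises over the independent selection bits, and each factor is [1 + q *
    (expR a - 1) <= expR (expR a * q)] with [q = r u ^+ 2]. *)
Lemma expect_exp_retained (R : realType) (J : finType) (r : J -> R) (a M : R) :
  (forall u, 0 < r u <= 1) -> \sum_u r u ^+ 2 <= M ->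
  expect (sparse_law r) (fun w => expR (a * #|retained w|%:R)) <=
  expR (expR a * M).
Proof.
move=> r01 rM.
have -> : (fun w : {ffun J -> bool * bool * bool} =>
    expR (a * #|retained w|%:R)) =
  fun w => \prod_u (if (w u).1.2 then expR a else 1).
  apply: funext => w; rewrite -sum1_card natr_sum mulr_sumr expR_sum.
  by rewrite big_mkcond; apply: eq_bigr => u _; rewrite inE mulr1.
rewrite (expect_prod _ (fun _ o => if o.1.2 then expR a else 1)).
apply: (@le_trans _ _ (\prod_u expR (expR a * r u ^+ 2))).
  apply: ler_prod => u _; apply/andP; split.
    apply: sumr_ge0 => o _; rewrite mulr_ge0 ?sparse_law_ge0 //.
    by case: ifP => // _; exact: expR_ge0.
  apply: le_trans (expR_ge1Dx _); rewrite sum_bool3 /sparse_law /=.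
  have := sqr_ge0 (r u); lra.
rewrite -expR_sum ler_expR -mulr_sumr ler_wpM2l //; exact: expR_ge0.
Qed.

(** The exponent collects [h]-th powers of four growth factors: one for each of the two norms and
    two from the squared cardinality bound. *)
Lemma pow_retained_le (R : realType) (h s n : nat) :
  (0 < s)%N -> (2 * h <= s)%N ->
  (1 + 3 * (n%:R / s%:R)) ^+ (4 * h) <= expR (6 * n%:R) :> R.
Proof.
move=> s0 hs; have sR : 0 < (s%:R : R) by rewrite ltr0n.
have p0 : 0 <= 3 * (n%:R / s%:R) :> R by rewrite mulr_ge0 ?divr_ge0.
apply: (@le_trans _ _ (expR (3 * (n%:R / s%:R)) ^+ (4 * h))).
  by rewrite lerXn2r ?nnegrE ?expR_ge0 ?addr_ge0 // expR_ge1Dx.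
rewrite -expRM_natl ler_expR.
have -> : (4 * h)%:R * (3 * (n%:R / s%:R)) =
  6 * n%:R * ((2 * h)%:R / s%:R) :> R by rewrite !natrM; field; rewrite gt_eqF.
by rewrite ler_piMr ?mulr_ge0 // ler_pdivrMr // mul1r ler_nat.
Qed.

(** * Induction over the tensor factors *)

Definition block_cst (R : realType) : R := 64 * expR (3 * expR 6).

(* L lists the tensor factors still to be sparsified; c bounds the number of
   indices of W with prescribed coordinates in the factors of L, so that W has at
   most c * \prod_(j in L) #|S_j| elements after restriction to supports S_j. *)
Lemma sign_moment_bound (R : realType) (K J : finType) (d : nat)
    (rho : 'I_d -> K -> J) (blk : J -> 'I_d)
    (blkK : forall j k, blk (rho j k) = j)
    (B : K -> K -> R) (h s t : nat) (D : R) :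
  (0 < s)%N -> (0 < t)%N -> (2 * h <= s)%N -> (s <= 3 * h)%N -> 0 <= D ->
  (forall (W : {set K}) (u v : K -> R),
     (forall k, k \notin W -> u k = 0) -> (forall k, k \notin W -> v k = 0) ->
     bil B u v ^+ 2 <= D * (1 + #|W|%:R / t%:R) ^+ 2 * nsq u * nsq v) ->
  forall (L : seq 'I_d) (W : {set K}) (c : nat) (y z : K -> R),
  (forall k, k \in W ->
    #|[set k' in W | all (fun j => rho j k' == rho j k) L]| <= c)%N ->
  (forall k, k \notin W -> y k = 0) -> (forall k, k \notin W -> z k = 0) ->
  sign_moment rho B h y z <= (block_cst R ^+ size L * D *
    (1 + c%:R * s%:R ^+ size L / t%:R) ^+ 2 * nsq y * nsq z) ^+ h.
Proof.
move=> s0 t0 hs sh D0 sparse; have tR : 0 < (t%:R : R) by rewrite ltr0n.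
have sR : 0 < (s%:R : R) by rewrite ltr0n.
have C0 : 0 < block_cst R by rewrite mulr_gt0 // expR_gt0.
elim=> [|j L IH] W c y z Wc yW zW /=.
  apply: sign_moment_le => σ.
  apply: le_trans (sparse W _ _ _ _) _; last 1 first.
  - rewrite !nsq_flip !expr0 mul1r mulr1.
    apply: ler_wpM2r; first exact: nsq_ge0.
    apply: ler_wpM2r; first exact: nsq_ge0.
    apply: ler_wpM2l => //.
    rewrite lerXn2r // ?nnegrE ?addr_ge0 ?divr_ge0 // lerD2l.
    rewrite ler_pM2r ?invr_gt0 // ler_nat.
    (* With no factor left, the fibre through any [k] of [W] is all of [W]; an empty [W] has no such
       [k]. *)
    have [->|[k kW]] := set_0Vmem W; first by rewrite cards0.
    apply: leq_trans (Wc k kW); apply: subset_leq_card.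
    by apply/fintype.subsetP => k' k'W; rewrite !inE k'W.
  - by move=> k /yW ->; rewrite mulr0.
  - by move=> k /zW ->; rewrite mulr0.
pose r := keep_root (rho j) s y z.
have r01 u : 0 < r u <= 1 by exact: keep_root_range.
have r0 u : 0 < r u by case/andP: (r01 u).
set M := block_cst R ^+ size L * D *
    (1 + c%:R * s%:R ^+ (size L).+1 / t%:R) ^+ 2 * nsq y * nsq z.
have M0 : 0 <= M by rewrite !mulr_ge0 ?nsq_ge0 ?sqr_ge0 ?exprn_ge0 // ltW.
have M16 : 0 <= 16 * M by rewrite mulr_ge0.
have term (x x' : J -> bool * bool * bool -> R) :
    (forall u o, x u o ^+ 2 <= if o.1.2 then 4 / r u ^+ 2 else 0) ->
    (forall u o, x' u o ^+ 2 <= if o.1.2 then 4 / r u ^+ 2 else 0) ->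
    expect (sparse_law r) (fun w => sign_moment rho B h
      (rescale (rho j) x w y) (rescale (rho j) x' w z)) <=
    (16 * M * expR (3 * expR 6)) ^+ h.
  move=> x4 x4'.
  have supp (v : K -> R) (x1 : J -> bool * bool * bool -> R) w :
      (forall k, k \notin W -> v k = 0) ->
      (forall u o, x1 u o ^+ 2 <= if o.1.2 then 4 / r u ^+ 2 else 0) ->
      forall k, k \notin [set k in W | rho j k \in retained w] ->
      rescale (rho j) x1 w v k = 0.
    move=> vW x14 k; rewrite !inE negb_and => /orP[/vW|]; rewrite /rescale.
      by move=> ->; rewrite mulr0.
    have := x14 (rho j k) (w (rho j k)); case: ifP => // _ xw _.
    suff -> : x1 (rho j k) (w (rho j k)) = 0 by rewrite mul0r.
    by apply/eqP; rewrite -sqrf_eq0 eq_le xw sqr_ge0.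
  have bound w : sign_moment rho B h (rescale (rho j) x w y)
      (rescale (rho j) x' w z) <=
      (16 * M) ^+ h * expR (6 * #|retained w|%:R).
    apply: le_trans (IH _ (c * #|retained w|)%N _ _ _ (supp y x w yW x4)
      (supp z x' w zW x4')) _.
      by move=> k _; exact: card_fiber_restrict.
    apply: (@le_trans _ _ ((16 * M) ^+ h *
      (1 + 3 * (#|retained w|%:R / s%:R)) ^+ (4 * h))); last first.
      by apply: ler_wpM2l; [exact: exprn_ge0 | exact: pow_retained_le].
    rewrite exprM -exprMn.
    have Hy : nsq (rescale (rho j) x w y) <=
        4 * (1 + 3 * (#|retained w|%:R / s%:R)) * nsq y.
      by apply: (nsq_retained _ s0 _ x4) => u; case: (slice_importance (rho j) y z u).
    have Hz : nsq (rescale (rho j) x' w z) <=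
        4 * (1 + 3 * (#|retained w|%:R / s%:R)) * nsq z.
      by apply: (nsq_retained _ s0 _ x4') => u; case: (slice_importance (rho j) y z u).
    have p0 : 0 <= #|retained w|%:R / s%:R :> R by rewrite divr_ge0.
    set p := #|retained w|%:R / s%:R in p0 Hy Hz *.
    have q0 : 0 <= c%:R * s%:R ^+ (size L).+1 / t%:R :> R.
      by rewrite !mulr_ge0 ?exprn_ge0 ?invr_ge0.
    (* The actual support size replaces [s] in the cardinality bound; the ratio [p] of the two is
       absorbed by [1 + 3 * p]. *)
    have Hc : 1 + (c * #|retained w|)%:R * s%:R ^+ size L / t%:R <=
        (1 + 3 * p) * (1 + c%:R * s%:R ^+ (size L).+1 / t%:R).
      have -> : (c * #|retained w|)%:R * s%:R ^+ size L / t%:R =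
          p * (c%:R * s%:R ^+ (size L).+1 / t%:R) :> R.
        rewrite natrM exprS /p; field; by rewrite !gt_eqF.
      move: q0; move: (_ / t%:R) => q q0.
      have := mulr_ge0 p0 q0; lra.
    apply: lerXn2r; rewrite ?nnegrE.
    - by rewrite !mulr_ge0 ?nsq_ge0 ?sqr_ge0 ?exprn_ge0 // ltW.
    - by rewrite mulr_ge0 // exprn_ge0 // addr_ge0 // mulr_ge0.
    have -> : 16 * M * (1 + 3 * p) ^+ 4 =
      block_cst R ^+ size L * D *
       ((1 + 3 * p) * (1 + c%:R * s%:R ^+ (size L).+1 / t%:R)) ^+ 2 *
       (4 * (1 + 3 * p) * nsq y) * (4 * (1 + 3 * p) * nsq z) by rewrite /M; ring.
    apply: ler_pM => //; rewrite ?nsq_ge0 ?mulr_ge0 ?nsq_ge0 ?sqr_ge0 ?exprn_ge0 //;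
      try exact: ltW.
    apply: ler_pM => //; rewrite ?nsq_ge0 ?mulr_ge0 ?nsq_ge0 ?sqr_ge0 ?exprn_ge0 //;
      try exact: ltW.
    apply: ler_wpM2l; first by rewrite mulr_ge0 ?exprn_ge0 // ltW.
    rewrite lerXn2r // nnegrE ?mulr_ge0 ?addr_ge0 ?mulr_ge0 ?invr_ge0 ?exprn_ge0 //.
  apply: le_trans (ler_expect _ bound) _.
    by move=> u o; exact: sparse_law_ge0.
  rewrite expectZ [leRHS]exprMn ler_wpM2l ?exprn_ge0 //.
  apply: le_trans (@expect_exp_retained _ _ _ _ s%:R r01 _) _.
    rewrite (eq_bigr (keep_prob (rho j) s y z)) ?sum_keep_prob // => u _.
    exact: keep_root_sqr.
  (* The hypothesis [s <= 3 * h] turns [expR (expR 6 * s%:R)] into an [h]-th power. *)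
  rewrite -expRM_natl ler_expR [leLHS]mulrC [leRHS]mulrA ler_wpM2r ?expR_ge0 //.
  by rewrite -natrM ler_nat mulnC.
apply: le_trans (@sign_moment_block _ _ _ _ _ blk blkK _ _ r j _ _ r01) _.
apply: (@le_trans _ _ (2^-1 * 2 ^+ (2 * h) *
   ((16 * M * expR (3 * expR 6)) ^+ h + (16 * M * expR (3 * expR 6)) ^+ h))).
  rewrite ler_wpM2l ?mulr_ge0 ?exprn_ge0 // lerD //; apply: term => u o;
    by case: (@sparse_coef_sqr _ _ r u o (r0 u)).
(* The 64 in [block_cst] is 4 from decoupling times 4 from the growth of each of the two norms; the
   exponential is the cost of the random support. *)
have -> : block_cst R ^+ (size L).+1 * D *
   (1 + c%:R * s%:R ^+ (size L).+1 / t%:R) ^+ 2 * nsq y * nsq z =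
   2 ^+ 2 * (16 * M * expR (3 * expR 6)).
  by rewrite exprS {1}/block_cst /M; ring.
rewrite [leRHS]exprMn -exprM; set a := _ ^+ h; set b := _ ^+ (2 * h).
by rewrite (_ : 2^-1 * b * (a + a) = b * a) //; field.
Qed.

(** * Restricted isometry and sparse bilinear forms *)

Lemma bil_suml (R : comNzRingType) (K S : finType) (B : K -> K -> R)
    (u : S -> K -> R) (v : K -> R) :
  bil B (fun k => \sum_a u a k) v = \sum_a bil B (u a) v.
Proof.
rewrite /bil [RHS]exchange_big; apply: eq_bigr => k _ /=.
rewrite [RHS]exchange_big; apply: eq_bigr => l _ /=.
by rewrite mulr_sumr mulr_suml.
Qed.

Lemma bil_sumr (R : comNzRingType) (K S : finType) (B : K -> K -> R)
    (u : K -> R) (v : S -> K -> R) :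
  bil B u (fun k => \sum_a v a k) = \sum_a bil B u (v a).
Proof.
rewrite /bil [RHS]exchange_big; apply: eq_bigr => k _ /=.
rewrite [RHS]exchange_big; apply: eq_bigr => l _ /=.
by rewrite mulr_sumr.
Qed.

Lemma bilZl (R : comNzRingType) (K : finType) (B : K -> K -> R) (c : R) u v :
  bil B (fun k => c * u k) v = c * bil B u v.
Proof.
rewrite /bil mulr_sumr; apply: eq_bigr => k _; rewrite mulr_sumr.
by apply: eq_bigr => l _; rewrite !mulrA [B k l * c]mulrC.
Qed.

Lemma nsqZ (R : comNzRingType) (K : finType) (c : R) (u : K -> R) :
  nsq (fun k => c * u k) = c ^+ 2 * nsq u.
Proof. by rewrite mulr_sumr; apply: eq_bigr => k _; rewrite exprMn. Qed.

Lemma nsq_parallelogram (R : comNzRingType) (K : finType) (u v : K -> R) :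
  nsq (fun k => u k + v k) + nsq (fun k => u k - v k) = 2 * (nsq u + nsq v).
Proof.
rewrite /nsq -!big_split mulr_sumr; apply: eq_bigr => k _ /=; ring.
Qed.

Lemma bil_polarization (R : comNzRingType) (K : finType) (B : K -> K -> R)
    (u v : K -> R) : (forall k l, B k l = B l k) ->
  4 * bil B u v =
  bil B (fun k => u k + v k) (fun k => u k + v k) -
  bil B (fun k => u k - v k) (fun k => u k - v k).
Proof.
move=> Bsym.
have Bs : bil B u v = bil B v u.
  rewrite /bil exchange_big; apply: eq_bigr => k _; apply: eq_bigr => l _.
  by rewrite Bsym mulrAC.
rewrite (_ : 4 * _ = 2 * bil B u v + 2 * bil B v u); last by rewrite -Bs; ring.
rewrite /bil !mulr_sumr -!big_split -sumrB; apply: eq_bigr => k _ /=.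
rewrite !mulr_sumr -!big_split -sumrB; apply: eq_bigr => l _ /=; ring.
Qed.

(** Polarization: [u + v] and [u - v] have at most [2 * t] nonzero entries, and the parallelogram
    law adds up the two bounds. *)
Lemma bil_sparse_pair (R : realFieldType) (K : finType) (B : K -> K -> R)
    (t : nat) (delta : R) (u v : K -> R) :
  (forall k l, B k l = B l k) ->
  (forall x : K -> R, (#|[pred k | (x k != 0)%R]| <= 2 * t)%N ->
     `|bil B x x| <= delta * nsq x) ->
  (#|[pred k | (u k != 0)%R]| <= t)%N -> (#|[pred k | (v k != 0)%R]| <= t)%N ->
  `|bil B u v| <= delta / 2 * (nsq u + nsq v).
Proof.
move=> Bsym rip ut vt.
have supp (w : K -> R) : (forall k, u k = 0 -> v k = 0 -> w k = 0) ->
    (#|[pred k | (w k != 0)%R]| <= 2 * t)%N.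
  move=> uvw; rewrite mul2n -addnn; apply: leq_trans (leq_add ut vt).
  rewrite -cardUI; apply: leq_trans (leq_addr _ _).
  apply: subset_leq_card; apply/fintype.subsetP => k; rewrite !inE.
  apply: contraR; rewrite negb_or !negbK => /andP[/eqP u0 /eqP v0].
  by rewrite uvw.
have Hp := rip _ (supp (fun k => u k + v k) _).
have Hm := rip _ (supp (fun k => u k - v k) _).
have {}Hp := Hp (fun k u0 v0 => etrans (congr2 +%R u0 v0) (addr0 0)).
have {}Hm := Hm (fun k u0 v0 => etrans (congr2 (fun a b => a - b) u0 v0) (subr0 0)).
have P := bil_polarization u v Bsym; have N := nsq_parallelogram u v.
have := ler_normB (bil B (fun k => u k + v k) (fun k => u k + v k))
  (bil B (fun k => u k - v k) (fun k => u k - v k)).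
rewrite -P normrM (ger0_norm (_ : 0 <= 4)) // => Q.
have {}N : delta * nsq (fun k => u k + v k) + delta * nsq (fun k => u k - v k)
  = 2 * (delta * (nsq u + nsq v)) by rewrite -mulrDr N; ring.
lra.
Qed.

(** Chunks are runs of consecutive positions in [enum W], so the position modulo [t] is injective on
    each. *)
Lemma card_chunk (K : finType) (W : {set K}) (t a : nat) : (0 < t)%N ->
  (#|[set k in W | index k (enum W) %/ t == a]| <= t)%N.
Proof.
move=> t0; pose f k := Ordinal (ltn_pmod (index k (enum W)) t0).
rewrite -(@card_in_imset _ _ f); first by rewrite -[leqRHS]card_ord max_card.
move=> k l; rewrite !inE => /andP[kW /eqP ka] /andP[lW /eqP la] [kl].
have : index k (enum W) = index l (enum W).
  by rewrite (divn_eq (index k _) t) (divn_eq (index l _) t) kl ka la.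
by move/(index_inj _ _) => -> //; rewrite mem_enum.
Qed.

(** Apply [bil_sparse_pair] to all pairs of chunks. Each chunk meets [M] others, which gives the
    factor [M], at most [1 + #|W|%:R / t%:R]. *)
Lemma bil_chunks (R : realFieldType) (K : finType) (B : K -> K -> R)
    (t : nat) (delta : R) (W : {set K}) (u v : K -> R) :
  (0 < t)%N -> 0 <= delta -> (forall k l, B k l = B l k) ->
  (forall x : K -> R, (#|[pred k | (x k != 0)%R]| <= 2 * t)%N ->
     `|bil B x x| <= delta * nsq x) ->
  (forall k, k \notin W -> u k = 0) -> (forall k, k \notin W -> v k = 0) ->
  `|bil B u v| <= delta * (1 + #|W|%:R / t%:R) / 2 * (nsq u + nsq v).
Proof.
move=> t0 d0 Bsym rip uW vW.
pose ch k := (index k (enum W) %/ t)%N; pose M := (#|W| %/ t).+1.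
pose part (x : K -> R) (a : 'I_M) k := if ch k == a then x k else 0.
have chM k : k \in W -> (ch k < M)%N.
  by move=> kW; rewrite ltnS leq_div2r // ltnW // cardE index_mem mem_enum.
have partE x : (forall k, k \notin W -> x k = 0) ->
    x = fun k => \sum_a part x a k.
  move=> xW; apply: funext => k; have [kW|kW] := boolP (k \in W); last first.
    by rewrite xW // big1 // => a _; rewrite /part xW // if_same.
  rewrite (bigD1 (Ordinal (chM k kW))) //= big1 ?addr0 /part /= ?eqxx //.
  by move=> a; rewrite -val_eqE eq_sym /= => /negbTE ->.
have nsq_part x : (forall k, k \notin W -> x k = 0) ->
    nsq x = \sum_a nsq (part x a).
  move=> xW; rewrite exchange_big; apply: eq_bigr => k _ /=.
  have [kW|kW] := boolP (k \in W); last first.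
    by rewrite xW // expr0n big1 // => a _; rewrite /part xW // if_same expr0n.
  rewrite (bigD1 (Ordinal (chM k kW))) //= big1 ?addr0 /part /= ?eqxx //.
  by move=> a; rewrite -val_eqE eq_sym /= => /negbTE ->; rewrite expr0n.
have supp x a : (forall k, k \notin W -> x k = 0) ->
    (#|[pred k | (part x a k != 0)%R]| <= t)%N.
  move=> xW; apply: leq_trans (@card_chunk K W t a t0).
  apply: subset_leq_card; apply/fintype.subsetP => k; rewrite !inE /part.
  case: ifP => [cka xk|]; last by rewrite eqxx.
  by rewrite andbT; apply: contraR xk => /xW ->.
rewrite [in X in X <= _](partE u uW) [in X in X <= _](partE v vW) bil_suml.
apply: (@le_trans _ _ (\sum_a \sum_b
    (delta / 2 * (nsq (part u a) + nsq (part v b))))).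
  apply: le_trans (ler_norm_sum _ _ _) _; apply: ler_sum => a _.
  rewrite bil_sumr; apply: le_trans (ler_norm_sum _ _ _) _.
  apply: ler_sum => b _.
  exact: (bil_sparse_pair Bsym rip (supp _ _ uW) (supp _ _ vW)).
have -> : \sum_a \sum_b (delta / 2 * (nsq (part u a) + nsq (part v b))) =
    delta / 2 * (M%:R * (nsq u + nsq v)).
  under eq_bigr do rewrite -mulr_sumr big_split /= sumr_const -(nsq_part v vW).
  rewrite -mulr_sumr big_split /= sumr_const sumrMnl -(nsq_part u uW) card_ord.
  by rewrite -mulrnDl mulr_natl.
rewrite mulrA ler_wpM2r ?addr_ge0 ?nsq_ge0 // [leRHS]mulrAC ler_wpM2l ?divr_ge0 //.
rewrite /M -add1n natrD lerD2l ler_pdivlMr ?ltr0n // -natrM ler_nat.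
exact: leq_trunc_div.
Qed.

(** The left side is linear in the scaling [a] and the right side quadratic, so optimising [a] turns
    the sum of squared norms into their product. *)
Lemma bil_sqr_le (R : realFieldType) (K : finType) (B : K -> K -> R) (c : R)
    (u v : K -> R) : 0 <= c ->
  (forall a : R, `|bil B (fun k => a * u k) v| <=
     c / 2 * (nsq (fun k => a * u k) + nsq v)) ->
  bil B u v ^+ 2 <= c ^+ 2 * nsq u * nsq v.
Proof.
move=> c0 H.
have {}H a : a * bil B u v <= c / 2 * (a ^+ 2 * nsq u + nsq v).
  by rewrite -nsqZ -bilZl; apply: le_trans (H a); exact: ler_norm.
set b := bil B u v in H *.
have nu := nsq_ge0 u; have nv := nsq_ge0 v.
have cu : 0 <= c * nsq u by exact: mulr_ge0.
have [cu0|cu0] := eqVneq (c * nsq u) 0.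
  suff -> : b = 0 by rewrite expr0n !mulr_ge0 // sqr_ge0.
  apply/eqP; apply: contraT => b0.
  (* Here the bound no longer grows with [a], and this [a] makes the left side exceed it. *)
  have := H ((c * nsq v + 1) / b); rewrite divfK //.
  have -> : forall a, c / 2 * (a ^+ 2 * nsq u + nsq v) =
    a ^+ 2 / 2 * (c * nsq u) + c * nsq v / 2 by move=> a; ring.
  rewrite cu0 mulr0 add0r; have := mulr_ge0 c0 nv; lra.
have {}cu : 0 < c * nsq u by rewrite lt_neqAle eq_sym cu0.
have c1 : 0 < c.
  by rewrite lt_neqAle c0 andbT eq_sym; apply: contraNneq cu0 => ->; rewrite mul0r.
(* This [a] maximises the difference of the two sides. *)
have := ler_wpM2r (ltW cu) (H (b / (c * nsq u))).
have [n0 cn0] : nsq u != 0 /\ c != 0.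
  by move: cu0; rewrite mulf_eq0 negb_or => /andP[].
rewrite (_ : b / (c * nsq u) * b * (c * nsq u) = b ^+ 2); last first.
  by field; rewrite ?n0 ?cn0.
rewrite (_ : _ * (c * nsq u) = b ^+ 2 / 2 + c ^+ 2 * nsq u * nsq v / 2); last first.
  by field; rewrite ?n0 ?cn0.
lra.
Qed.

Lemma sparse_bil_sqr (R : realFieldType) (K : finType) (B : K -> K -> R)
    (t : nat) (delta : R) (W : {set K}) (u v : K -> R) :
  (0 < t)%N -> 0 <= delta -> (forall k l, B k l = B l k) ->
  (forall x : K -> R, (#|[pred k | (x k != 0)%R]| <= 2 * t)%N ->
     `|bil B x x| <= delta * nsq x) ->
  (forall k, k \notin W -> u k = 0) -> (forall k, k \notin W -> v k = 0) ->
  bil B u v ^+ 2 <= delta ^+ 2 * (1 + #|W|%:R / t%:R) ^+ 2 * nsq u * nsq v.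
Proof.
move=> t0 d0 Bsym rip uW vW; rewrite -exprMn; apply: bil_sqr_le => [|a].
  by rewrite mulr_ge0 // addr_ge0 // divr_ge0.
by apply: bil_chunks => // k /uW ->; rewrite mulr0.
Qed.

Lemma l2norm_sqr (R : realType) (n : nat) (x : 'cV[R]_n) :
  l2norm x ^+ 2 = nsq (fun k => x k 0).
Proof. by rewrite sqr_sqrtr // sumr_ge0 // => i _; exact: sqr_ge0. Qed.

Definition gram_defect (R : realType) (m n : nat) (Phi : 'M[R]_(m, n))
    (k l : 'I_n) : R := (Phi^T *m Phi - 1%:M) k l.

Lemma gram_defect_sym (R : realType) (m n : nat) (Phi : 'M[R]_(m, n)) k l :
  gram_defect Phi k l = gram_defect Phi l k.
Proof.
rewrite /gram_defect; have E : (Phi^T *m Phi - 1%:M)^T = Phi^T *m Phi - 1%:M.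
  by rewrite linearB /= trmx_mul trmxK trmx1.
by rewrite -[in LHS]E mxE.
Qed.

Lemma bil_gram_defect (R : realType) (m n : nat) (Phi : 'M[R]_(m, n))
    (x : 'cV[R]_n) :
  bil (gram_defect Phi) (fun k => x k 0) (fun k => x k 0) =
  l2norm (Phi *m x) ^+ 2 - l2norm x ^+ 2.
Proof.
have E (p : nat) (y : 'cV[R]_p) : l2norm y ^+ 2 = (y^T *m y) 0 0.
  by rewrite l2norm_sqr mxE; apply: eq_bigr => k _; rewrite mxE expr2.
rewrite !E trmx_mul.
transitivity ((x^T *m (Phi^T *m Phi - 1%:M) *m x) 0 0); last first.
  by rewrite mulmxBr mulmxBl mulmx1 !mulmxA !mxE.
rewrite mxE /bil exchange_big; apply: eq_bigr => l _ /=.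
rewrite mxE mulr_suml; apply: eq_bigr => k _.
by rewrite mxE [_ * x k 0]mulrC.
Qed.

Lemma RIP_gram_defect (R : realType) (m n : nat) (Phi : 'M[R]_(m, n)) k delta
    (x : 'I_n -> R) : RIP Phi k delta -> (#|[pred i | (x i != 0)%R]| <= k)%N ->
  `|bil (gram_defect Phi) x x| <= delta * nsq x.
Proof.
move=> rip xk; pose y : 'cV[R]_n := \col_i x i.
have yx : (fun i => y i 0) = x by apply: funext => i; rewrite mxE.
rewrite -yx bil_gram_defect -l2norm_sqr.
have [|lo hi] := rip y.
  apply: leq_trans xk; apply: subset_leq_card; apply/fintype.subsetP => i.
  by rewrite !inE mxE.
by rewrite ler_norml; apply/andP; split; lra.
Qed.

(** Test on a standard basis vector: there [delta] bounds an absolute value. *)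
Lemma RIP_ge0 (R : realType) (m n : nat) (Phi : 'M[R]_(m, n)) k delta :
  (0 < n)%N -> (0 < k)%N -> RIP Phi k delta -> 0 <= delta.
Proof.
move=> n0 k0 rip; pose x (i : 'I_n) : R := (i == Ordinal n0)%:R.
have := @RIP_gram_defect _ _ _ _ _ _ x rip.
have -> : nsq x = 1.
  rewrite /nsq (bigD1 (Ordinal n0)) //= big1 /x ?eqxx ?expr1n ?addr0 //.
  by move=> i /negbTE ->; rewrite expr0n.
rewrite mulr1 => H; apply: le_trans (normr_ge0 _) (H _).
apply: leq_trans k0; rewrite -(card1 (Ordinal n0)); apply: subset_leq_card.
apply/fintype.subsetP => i; rewrite !inE /x.
by apply: contraR => /negbTE ->; rewrite eqxx.
Qed.

(** * Coordinates of the Kronecker product *)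

Lemma ord_fun_cons (d : nat) (n : 'I_d.+1 -> nat) (a : 'I_(n ord0))
    (f : forall j, 'I_(n (lift ord0 j))) :
  exists g : forall j, 'I_(n j), g ord0 = a /\ forall j, g (lift ord0 j) = f j.
Proof.
(* The type of the value depends on [j], so both prescriptions are stated through casts along an
   equality with [j], which makes sense for every [j]. *)
pose P j (x : 'I_(n j)) := (forall e : ord0 = j, x = ecast i 'I_(n i) e a) /\
  (forall j' (e : lift ord0 j' = j), x = ecast i 'I_(n i) e (f j')).
have PE j : exists x, P j x.
  case: (unliftP ord0 j) => [j'|] ->.
    exists (f j'); split => [e|j2 e]; first by have := congr1 val e.
    by have j2E := lift_inj e; subst j2; rewrite (eq_axiomK e).
  exists a; split => [e|j2 e]; first by rewrite (eq_axiomK e).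
  by have := congr1 val e.
exists (fun j => projT1 (cid (PE j))); split => [|j]; case: cid => x /= [x1 x2].
  exact: (x1 erefl).
exact: (x2 _ erefl).
Qed.

(** Hides the index encoding of [kron]: later only the product formula and the fact that coordinates
    determine the index are used. *)
Lemma kron_coord (R : realType) (d : nat) (n : 'I_d -> nat) :
  exists pi : forall j, 'I_(\prod_(j < d) n j) -> 'I_(n j),
    (forall (v : forall j, 'cV[R]_(n j)) k,
       kron v k 0 = \prod_j v j (pi j k) 0) /\
    (forall k l, (forall j, pi j k = pi j l) -> k = l).
Proof.
elim: d n => [|d IH] n.
  exists (fun (j : 'I_0) _ => False_rect _ (Bool.diff_false_true (ltn_ord j))).
  split=> [v k|k l _]; first by rewrite [RHS]big_ord0 mxE.
  have N1 : (\prod_(j < 0) n j = 1)%N by rewrite big_ord0.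
  apply: val_inj; have lt1 (i : 'I_(\prod_(j < 0) n j)) : val i = 0%N.
    by apply/eqP; rewrite -leqn0 -ltnS (leq_trans (ltn_ord i)) // N1.
  by rewrite !lt1.
have [pi [piE pi_inj]] := IH (fun j => n (lift ord0 j)).
pose un (k : 'I_(\prod_(j < d.+1) n j)%N) :=
  mxtens.mxtens_unindex (cast_ord (big_ord_recl d n) k).
pose G k := cid (ord_fun_cons (un k).1 (fun j => pi j (un k).2)).
exists (fun j k => projT1 (G k) j); split=> [v k|k l kl].
  case: (projT2 (G k)) => G0 G1; rewrite [RHS]big_ord_recl G0 /= castmxE mxE.
  rewrite esymK; congr (_ * _); first by rewrite [in LHS]ord1.
  rewrite [X in kron _ _ X]ord1 piE; apply: eq_bigr => j _.
  by congr (v _ _ _); exact: (esym (G1 j)).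
case: (projT2 (G k)) => Gk0 Gk1; case: (projT2 (G l)) => Gl0 Gl1.
apply: (@cast_ord_inj _ _ (big_ord_recl d n)).
apply: (can_inj (@mxtens.mxtens_unindexK _ _)).
rewrite [LHS]surjective_pairing [RHS]surjective_pairing; congr (_, _).
  by rewrite -[LHS]Gk0 -[RHS]Gl0 kl.
by apply: pi_inj => j; rewrite -[LHS]Gk1 -[RHS]Gl1 kl.
Qed.

(** * Sign patterns of independent Rademacher vectors *)

Lemma bigcap_finType (T : Type) (I : finType) (F : I -> set T) :
  \bigcap_(i in [set` [set: I]%SET]) F i = [set t | forall i, F i t].
Proof.
by apply/seteqP; split=> [t Ft i|t Ft i _]; [apply: Ft; rewrite /= inE|exact: Ft].
Qed.

Definition sign_event (R : realType) (disp : measure_display)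
    (T : measurableType disp) (P : probability T R) (d : nat) (n : 'I_d -> nat)
    (xi : forall j : 'I_d, {RV P >-> (n j).-tuple R})
    (s : {ffun {j : 'I_d & 'I_(n j)} -> bool}) : set T :=
  [set t | forall (j : 'I_d) (i : 'I_(n j)),
    tnth (xi j t) i = (-1) ^+ s (Tagged (fun j => 'I_(n j)) i)].

Lemma measurable_tuple_eq (R : realType) (n : nat) (v : 'I_n -> R) :
  measurable [set u : n.-tuple R | forall i, tnth u i = v i].
Proof.
rewrite -(bigcap_finType (fun i => [set u : n.-tuple R | tnth u i = v i])).
apply: fin_bigcap_measurable => [|i _]; first exact: finite_finset.
have := measurable_tnth i measurableT (measurable_set1 (v i)).
by rewrite setTI.
Qed.

Lemma measurable_sign_event (R : realType) (disp : measure_display)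
    (T : measurableType disp) (P : probability T R) (d : nat) (n : 'I_d -> nat)
    (xi : forall j : 'I_d, {RV P >-> (n j).-tuple R}) s :
  measurable (sign_event xi s).
Proof.
rewrite /sign_event -(bigcap_finType (fun j => xi j @^-1` [set u | forall i,
  tnth u i = (-1) ^+ s (Tagged (fun j => 'I_(n j)) i)])).
apply: fin_bigcap_measurable => [|j _]; first exact: finite_finset.
exact: measurable_funPTI (measurable_tuple_eq _).
Qed.

(** Independence acts twice, between the vectors and between the entries of each; the nested product
    is then one over the tagged indices. *)
Lemma prob_sign_event (R : realType) (disp : measure_display)
    (T : measurableType disp) (P : probability T R) (d : nat) (n : 'I_d -> nat)
    (xi : forall j : 'I_d, {RV P >-> (n j).-tuple R}) s :
  (forall j, rademacher (xi j)) ->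
  mutually_independent P (fun j t => xi j t) ->
  P (sign_event xi s) = (2^-1 ^+ #|{: {j : 'I_d & 'I_(n j)}}|)%:E.
Proof.
move=> rad ind.
rewrite /sign_event -(bigcap_finType (fun j => xi j @^-1` [set u | forall i,
  tnth u i = (-1) ^+ s (Tagged (fun j => 'I_(n j)) i)])).
rewrite ind => [|j _]; last exact: measurable_tuple_eq.
have PE j : P (xi j @^-1` [set u | forall i,
    tnth u i = (-1) ^+ s (Tagged (fun j => 'I_(n j)) i)]) =
    (\prod_(i < n j) 2^-1 : R)%:E.
  have [ind_j rad_j] := rad j.
  have := ind_j [set: 'I_(n j)]%SET (fun i =>
    [set (-1) ^+ s (Tagged (fun j => 'I_(n j)) i)]).
  rewrite bigcap_finType => -> => [|i _]; last exact: measurable_set1.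
  rewrite (eq_bigl xpredT) => [|i]; last by rewrite inE.
  rewrite -prodEFin; apply: eq_bigr => i _.
  by case: (s _); rewrite ?expr1 ?expr0; case: (rad_j i).
under eq_bigr do rewrite PE.
rewrite (eq_bigl xpredT) => [|i]; last by rewrite inE.
rewrite prodEFin (sig_big_dep xpredT (fun _ => xpredT) (fun _ _ => 2^-1)) /=.
by rewrite prodr_const.
Qed.

Lemma measure_disjoint_union (disp : measure_display) (R : realFieldType)
    (T : ringOfSetsType disp) (mu : {content set T -> \bar R}) (S : eqType)
    (r : seq S) (A : S -> set T) :
  (forall s, measurable (A s)) -> uniq r ->
  (forall s s', s != s' -> A s `&` A s' = set0) ->
  mu (\big[setU/set0]_(s <- r) A s) = (\sum_(s <- r) mu (A s))%E.
Proof.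
move=> Am + Adis; elim: r => [|s r IH]; first by rewrite !big_nil measure0.
move=> /= /andP[sr ur]; rewrite !big_cons measureU ?IH //.
  exact: bigsetU_measurable.
rewrite big_distrr /= big1_seq // => s' /andP[_ s'r]; apply: Adis.
by apply: contraNneq sr => ->.
Qed.

Lemma sign_event_disjoint (R : realType) (disp : measure_display)
    (T : measurableType disp) (P : probability T R) (d : nat) (n : 'I_d -> nat)
    (xi : forall j : 'I_d, {RV P >-> (n j).-tuple R}) s s' :
  s != s' -> sign_event xi s `&` sign_event xi s' = set0.
Proof.
move=> ss'; apply/seteqP; split=> // t [st s't].
apply: (negP ss'); apply/eqP/ffunP => -[j i]; apply: (@signr_inj R).
by rewrite -[LHS](st j i) -[RHS](s't j i).
Qed.

(** Signs are attained only almost surely, so [E] is bounded through a complement: it misses every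
    event of a pattern outside [bad]. These events are disjoint with known mass, and outcomes that
    are not signs fall into the complement. *)
Lemma prob_le_count (R : realType) (disp : measure_display)
    (T : measurableType disp) (P : probability T R) (d : nat) (n : 'I_d -> nat)
    (xi : forall j : 'I_d, {RV P >-> (n j).-tuple R}) (E : set T)
    (bad : pred {ffun {j : 'I_d & 'I_(n j)} -> bool}) :
  (forall j, rademacher (xi j)) ->
  mutually_independent P (fun j t => xi j t) ->
  measurable E ->
  (forall s t, sign_event xi s t -> E t -> bad s) ->
  (P E <= (2^-1 ^+ #|{: {j : 'I_d & 'I_(n j)}}| * #|bad|%:R)%:E)%E.
Proof.
move=> rad ind Em Ebad.
pose good := \big[setU/set0]_(s <- enum (predC bad)) sign_event xi s.
have goodm : measurable good.
  by apply: bigsetU_measurable => s _; exact: measurable_sign_event.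
have P_good : P good =
    (2^-1 ^+ #|{: {j : 'I_d & 'I_(n j)}}| * #|predC bad|%:R)%:E.
  rewrite measure_disjoint_union ?enum_uniq //; first last.
  - exact: sign_event_disjoint.
  - by move=> s; exact: measurable_sign_event.
  rewrite (eq_bigr (fun=> (2^-1 ^+ #|{: {j : 'I_d & 'I_(n j)}}|)%:E)); last first.
    by move=> s _; exact: prob_sign_event.
  by rewrite sumEFin big_const_seq count_predT -cardE iter_addr_0 mulr_natr.
have sub : E `<=` ~` good.
  move=> t Et; rewrite /good -bigcup_seq => -[s /= sb st].
  by move: sb; rewrite mem_enum inE /= (Ebad s t).
apply: (@le_trans _ _ (P (~` good))).
  by apply: le_measure => //; rewrite inE //; exact: measurableC.
rewrite probability_setC // P_good -EFinB lee_fin.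
have := cardC bad; rewrite card_ffun card_bool => cb.
have : (2^-1 : R) ^+ #|{: {j : 'I_d & 'I_(n j)}}| * (#|bad| + #|predC bad|)%:R = 1.
  by rewrite cb natrX -exprMn mulVf // expr1n.
by rewrite natrD mulrDr => e; rewrite lerBlDr e.
Qed.

(** The deviation is a polynomial in the entries of the random vectors. *)
Lemma measurable_kron_event (R : realType) (disp : measure_display)
    (T : measurableType disp) (P : probability T R) (d : nat) (n : 'I_d -> nat)
    (xi : forall j : 'I_d, {RV P >-> (n j).-tuple R}) (m : nat)
    (Phi : 'M[R]_(m, \prod_(j < d) n j)) (x : 'cV[R]_(\prod_(j < d) n j)) (e : R) :
  measurable [set t | e < `| l2norm (Phi *m
    diag_mx (kron (fun j => colvec (xi j t)))^T *m x) ^+ 2 - 1 |].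
Proof.
have [pi [piE _]] := kron_coord R n.
pose f t := \sum_i (\sum_k Phi i k *
  ((\prod_j tnth (xi j t) (pi j k)) * x k 0)) ^+ 2 - 1.
have fE t : l2norm (Phi *m diag_mx (kron (fun j => colvec (xi j t)))^T *m x) ^+ 2
    - 1 = f t.
  rewrite l2norm_sqr; congr (_ - _); apply: eq_bigr => i _; congr (_ ^+ _).
  rewrite -mulmxA mxE; apply: eq_bigr => k _; congr (_ * _).
  rewrite mul_diag_mx !mxE piE; congr (_ * _).
  by apply: eq_bigr => j _; rewrite mxE.
have mf : measurable_fun setT f.
  apply: measurable_funB => //; apply: measurable_sum => i.
  apply: measurable_funX; apply: measurable_sum => k.
  apply: measurable_funM => //; apply: measurable_funM => //.
  apply: measurable_prod => j _.
  exact: (measurableT_comp (measurable_tnth _) (measurable_funPT (xi j))).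
have := measurableT_comp (@normr_measurable R setT) mf.
move=> /(_ measurableT `]e, +oo[%classic (measurable_itv _)).
rewrite setTI; congr measurable; apply/seteqP; split=> t /=;
  by rewrite in_itv /= andbT fE.
Qed.

(** * Tail bound and conclusion *)

Lemma block_cst_ge1 (R : realType) : 1 <= block_cst R.
Proof.
have : 1 <= expR (3 * expR 6) :> R.
  by apply: le_trans (expR_ge1Dx _); rewrite lerDl mulr_ge0 ?expR_ge0.
rewrite /block_cst; lra.
Qed.

(** Markov's inequality for the moment of order [2 * h], where [h] is half of [s] rounded down. *)
Lemma mean_power_tail (R : realType) (d : nat) (K J : finType)
    (rho : 'I_d -> K -> J) (blk : J -> 'I_d) (B : K -> K -> R)
    (s : nat) (delta epsilon : R) (x : K -> R) :
  (forall j k, blk (rho j k) = j) ->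
  (forall k l, (forall j, rho j k = rho j l) -> k = l) ->
  (2 <= s)%N -> 0 <= delta -> 0 < epsilon ->
  delta <= (2 * expR 1 * block_cst R ^+ d)^-1 * epsilon ->
  (forall k l, B k l = B l k) ->
  (forall x : K -> R, (#|[pred k | (x k != 0)%R]| <= 2 * s ^ d)%N ->
     `|bil B x x| <= delta * nsq x) ->
  nsq x = 1 ->
  (2^-1 : R) ^+ #|J| * #|[pred f : {ffun J -> bool} |
     (epsilon < `|bil B (fun k => flip R rho f k * x k)
                        (fun k => flip R rho f k * x k)|)%R]|%:R
  <= expR (1 - s%:R).
Proof.
move=> blkK inj s2 d0 e0 de Bsym sparse x1.
have s0 : (0 < s)%N by exact: leq_trans s2.
pose h := s./2.
have h1 : (0 < h)%N by rewrite half_gt0.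
have hE : (s = odd s + 2 * h)%N by rewrite mul2n odd_double_half.
have hs : (2 * h <= s)%N by rewrite [X in (_ <= X)%N]hE leq_addl.
have hs1 : (s <= (2 * h).+1)%N.
  by rewrite [X in (X <= _)%N]hE -[(2 * h).+1]add1n leq_add2r; case: odd.
have sh : (s <= 3 * h)%N by apply: leq_trans hs1 _; lia.
have t0 : (0 < s ^ d)%N by rewrite expn_gt0 s0.
(* All coordinates together determine an index, so [c = 1]; with [t = s ^ d] the cardinality factor
   becomes [(1 + 1) ^+ 2]. *)
have := @sign_moment_bound R K J d rho blk blkK B h s (s ^ d) (delta ^+ 2)
  s0 t0 hs sh (sqr_ge0 _) _ (enum 'I_d) [set: K] 1 x x.
have C1 := block_cst_ge1 R.
have C0 : 0 < block_cst R by exact: lt_le_trans C1.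
rewrite size_enum_ord natrX mul1r divff ?expf_neq0 ?pnatr_eq0 -?lt0n //.
rewrite x1 !mulr1 => /(_ _ _ _ _)/le_trans main.
set M := _ * _ * (1 + 1) ^+ 2 in main.
have M0 : 0 <= M by rewrite !mulr_ge0 ?sqr_ge0 // exprn_ge0 // ltW.
apply: (@le_trans _ _ (sign_moment rho B h x x / epsilon ^+ (2 * h))).
  rewrite ler_pdivlMr ?exprn_gt0 // -mulrA ler_wpM2l ?exprn_ge0 ?invr_ge0 //.
  rewrite mulrC mulr_natr -sumr_const [leLHS]big_mkcond /=.
  apply: ler_sum => f _; rewrite inE; set b := bil _ _ _.
  have b0 : 0 <= b ^+ (2 * h) by rewrite exprM exprn_ge0 ?sqr_ge0.
  case: ifP => // eb; rewrite -(ger0_norm b0) normrX.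
  by rewrite lerXn2r ?nnegrE ?normr_ge0 // ltW.
rewrite ler_pdivrMr ?exprn_gt0 //; apply: main.
- by move=> W u v uW vW; rewrite -natrX; apply: sparse_bil_sqr.
- move=> k _; rewrite -(cards1 k); apply: subset_leq_card.
  apply/fintype.subsetP => l; rewrite !inE /= => /allP kl.
  by apply/eqP/inj => j; apply/eqP/kl; rewrite mem_enum.
- by move=> k; rewrite inE.
- by move=> k; rewrite inE.
have ME : M <= (expR (-1) * epsilon) ^+ 2.
  have Cd : 0 < block_cst R ^+ d by rewrite exprn_gt0.
  have -> : M = block_cst R ^+ d * (2 * delta) ^+ 2 by rewrite /M; ring.
  (* Squaring [block_cst R ^+ d], which is at least 1, makes the bound a perfect square; the
     constant in the hypothesis on [delta] is chosen to bring its root below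
     [expR (-1) * epsilon]. *)
  apply: (@le_trans _ _ ((block_cst R ^+ d * (2 * delta)) ^+ 2)).
    rewrite [leRHS]exprMn ler_wpM2r ?sqr_ge0 // expr2 ler_peMl ?(ltW Cd) //.
    exact: exprn_ege1.
  apply: lerXn2r; rewrite ?nnegrE.
  - by rewrite mulr_ge0 ?(ltW Cd) // mulr_ge0.
  - by rewrite mulr_ge0 ?expR_ge0 ?(ltW e0).
  rewrite expRN.
  have E0 := expR_gt0 (1 : R).
  rewrite -(ler_pM2l (mulr_gt0 (mulr_gt0 (ltr0Sn R 1) E0) Cd)) in de.
  rewrite mulrA mulfV ?mul1r in de; last by rewrite !mulf_neq0 ?gt_eqF.
  rewrite -(ler_pM2l E0) mulrA mulVKf ?gt_eqF //.
  by apply: le_trans de; rewrite le_eqVlt; apply/predU1P; left; ring.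
apply: (@le_trans _ _ (((expR (-1) * epsilon) ^+ 2) ^+ h)).
  by rewrite lerXn2r // nnegrE ?sqr_ge0.
rewrite -exprM exprMn ler_wpM2r ?exprn_ge0 ?(ltW e0) // -expRM_natl ler_expR.
(* Rounding down loses at most one, which is the 1 in [expR (1 - s%:R)]. *)
have : s%:R <= (2 * h).+1%:R :> R by rewrite ler_nat.
rewrite -natr1; lra.
Qed.

Theorem theorem1 (R : realType) :
  exists C : nat -> R, (forall d : nat, 0 < C d) /\
  forall (d : nat) (n : 'I_d -> nat) (m : nat)
    (Phi : 'M[R]_(m, \prod_(j < d) n j)) (epsilon eta delta : R) (s : nat)
    (disp : measure_display) (T : measurableType disp) (P : probability T R)
    (xi : forall j : 'I_d, {RV P >-> (n j).-tuple R}),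
    (1 <= d)%N -> (forall j, 0 < n j)%N ->
    0 < epsilon < 1 -> 0 < eta < 1 ->
    ln (1 / eta) + 2 <= s%:R -> delta <= C d * epsilon ->
    RIP Phi (2 * s ^ d)%N delta ->
    (forall j, rademacher (xi j)) ->
    mutually_independent P (fun j t => xi j t) ->
    distributional_JL P
      (fun t => Phi *m diag_mx (kron (fun j => colvec (xi j t)))^T)
      epsilon eta.
Proof.
exists (fun d => (2 * expR 1 * block_cst R ^+ d)^-1); split=> [d|].
  have b0 : 0 < block_cst R by exact: lt_le_trans ltr01 (block_cst_ge1 R).
  by rewrite invr_gt0 !mulr_gt0 ?expR_gt0 ?exprn_gt0.
move=> d n m Phi epsilon eta delta s disp T P xi _ n0 /andP[e0 _] /andP[eta0 eta1].
rewrite div1r => ls de rip rad ind x x1.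
rewrite lnV // in ls; have leta : ln eta <= 0 by rewrite ln_le0 // ltW.
have s2 : (2 <= s)%N by rewrite -(ler_nat R); lra.
have N0 : (0 < \prod_(j < d) n j)%N by rewrite prodn_gt0.
have d0 : 0 <= delta.
  by apply: RIP_ge0 rip => //; rewrite muln_gt0 expn_gt0 (leq_trans _ s2).
have [pi [piE pi_inj]] := kron_coord R n.
(* Tagging makes the signs of all factors a single boolean function. *)
pose rho (j : 'I_d) k : {j : 'I_d & 'I_(n j)} := Tagged (fun j => 'I_(n j)) (pi j k).
pose sx f k := flip R rho f k * x k 0.
have nx : nsq (fun k => x k 0) = 1 by rewrite -l2norm_sqr x1 expr1n.
apply: (@le_trans _ _ (2^-1 ^+ #|{: {j : 'I_d & 'I_(n j)}}| *
  #|[pred f | (epsilon < `|bil (gram_defect Phi) (sx f) (sx f)|)%R]|%:R)%:E).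
  (* On the event of pattern [f] the vector [D_xi x] is [sx f], again of norm 1, so the deviation is
     its form under [gram_defect Phi]. *)
  apply: (prob_le_count rad ind (measurable_kron_event _ _ _ _)) => f t ft.
  rewrite /= -mulmxA; set y := _ *m x.
  have yE : (fun k => y k 0) = sx f.
    apply: funext => k; rewrite /y mul_diag_mx !mxE piE; congr (_ * _).
    by apply: eq_bigr => j _; rewrite mxE ft.
  have y1 : l2norm y ^+ 2 = 1 by rewrite l2norm_sqr yE nsq_flip.
  by rewrite /= -yE bil_gram_defect y1.
rewrite lee_fin; apply: (@le_trans _ _ (expR (1 - s%:R))).
  apply: (@mean_power_tail _ _ _ _ _ tag _ _ delta) => //.
  - by move=> k l kl; apply: pi_inj => j; exact: eq_from_Tagged (kl j).
  - exact: gram_defect_sym.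
  - by move=> v; exact: RIP_gram_defect.
(* In logarithms this is [1 - s%:R <= ln eta], implied by the lower bound on [s]. *)
rewrite -[leRHS]lnK ?posrE // ler_expR; lra.
Qed.
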